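(* Let $\ell>1$ and $\lambda,\mu\in\Bbbk$. The simple modules for $\mathcal{A}_{\lambda,\mu}$ are, up to isomorphism, the following. (1) If $(\lambda,\mu)=(0,0)$, there are $3\ell$ modules $L_S$, one for each $S\in\{S_j^+,S_j^-,M_j : j\in\mathbb{J}_0\}$, with $L_{S|}\simeq S$ and $a_0$ acting by $0$. (2) If $\mu=\frac{\lambda}{3}\neq 0$, there are $5\ell+1$ modules, namely: - two 1-dimensional modules $L_0^+$ and $L_0^-$, with $L^{\pm}_{0|}\simeq S_0^\pm$ and $a_0=0$; - four 2-dimensional modules $L_j(a,c)$, $a,c\in\{\pm\sqrt{\lambda/3}\}$, for each $j\in\mathbb{J}_0$; - one 2-dimensional module $T_j$ for each $j\in\mathbb{J}$, with $T_{j|}\simeq S_j^+\oplus S_j^-$ and $[a_0]=\begin{pmatrix}0&\mu(1-\zeta^j)\\1&0\end{pmatrix}$. (3) If $\mu\neq\frac{\lambda}{3}$, there are three cases. (a) If $\lambda\neq 0$ and $\mu\neq \mathfrak{c}_{\pm j}\frac{\lambda}{3}$ for every $j\in\mathbb{J}$, there are $2\ell+4$ modules: two 1-dimensional modules $L_0^\pm$ (with $a_0=0$); four 2-dimensional modules $L_0(a,c)$, $a,c\in\{\pm\sqrt{\lambda/3}\}$; two 6-dimensional modules $N_j^{(1)}$ and $N_j^{(2)}$ for each $j\in\mathbb{J}$. (b) If $\mu=\mathfrak{c}_{\pm j}\frac{\lambda}{3}\neq 0$ for a (unique) $j\in\mathbb{J}$, there are $2\ell+3$ modules: two 1-dimensional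 modules $L_0^\pm$; four 2-dimensional modules $L_0(a,c)$, $a,c\in\{\pm\sqrt{\lambda/3}\}$; one 6-dimensional module $N_j^{(1)}$, and two 6-dimensional modules $N_k^{(1)}$ and $N_k^{(2)}$ for each $k\in\mathbb{J}$, $k\neq j$. (c) If $\lambda=0$ and $\mu\neq 0$, there are $2\ell+1$ modules: two 1-dimensional modules $L_0^\pm$; one 2-dimensional module $L_0(0,0)$ (with $a_0=0$); two 6-dimensional modules $N_j^{(1)}$ and $N_j^{(2)}$ for each $j\in\mathbb{J}$.
   Context: $\Bbbk$ is an algebraically closed field of characteristic zero; modules are finite-dimensional left modules. Group and algebra: for $\ell\ge1$, $\mathbb{G}_{3,\ell}=\langle s,t\mid s^3=t^{2\ell}=1,\ ts=s^2t\rangle$ (order $6\ell$). $\mathcal{A}_{\lambda,\mu}$ is the algebra generated by $\Bbbk\mathbb{G}_{3,\ell}$ and $a_0,a_1,a_2$ (indices mod 3) with relations $ta_i=-a_{-i}t$, $sa_i=a_{i+1}s$, $a_0^2=a_1^2=a_2^2=\mu(1-t^2)$, $a_0a_1+a_1a_2+a_2a_0=\lambda(1-st^2)$, $a_1a_0+a_2a_1+a_0a_2=\lambda(1-s^2t^2)$ (the quotient of the smash product $\Bbbk\langle a_0,a_1,a_2\rangle\#\Bbbk\mathbb{G}_{3,\ell}$). It is generated by $a_0,s,t$. Notation: $\xi,\zeta\in\Bbbk$ are primitive roots of 1 of orders $3$ and $\ell$; $\mathbb{J}=\{1,\dots,\ell-1\}$, $\mathbb{J}_0=\mathbb{J}\cup\{0\}$;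 $b_j\in\Bbbk$ is fixed with $b_j^2=\zeta^j$, $b_0=1$. $M_|$ is the restriction of a module to $\mathbb{G}_{3,\ell}$. Columns of $[a_0]$ are the images of the basis vectors. The irreducible $\mathbb{G}_{3,\ell}$-modules are $S_j^\pm=\langle z_\pm\rangle$ with $s z_\pm=z_\pm$, $t z_\pm=\pm b_jz_\pm$, and $M_j=\langle v,w\rangle$ with $sv=\xi v$, $sw=\xi^2w$, $tv=w$, $tw=\zeta^jv$ ($j\in\mathbb{J}_0$). $L_j(a,c)$ is the module with $L_j(a,c)_|\simeq M_j$ and, in the basis $\{v,w\}$, $[a_0]=\begin{pmatrix}a&-\zeta^jc\\c&-a\end{pmatrix}$. Scalars, for $j\in\mathbb{J}$, $b=b_j$: $f=f_j=\frac{1}{9b}(\lambda-3\mu)(1-\zeta^j)$, $g_j=\frac19(3\mu+2\lambda)(1-\zeta^j)$, $f_{+j}=\frac{\mu}{3}(1-\zeta^{j})+\frac{\lambda}{9}(2+\zeta^{j})$, $h_j=\frac{\lambda}{9}(5+b_j^2)+\frac{\mu}{3}(1-b_j^2)$, $\mathfrak{s}_j=\frac12\big(h_j+\sqrt{h_j^2-4f_{+j}g_j}\big)$ (with the square root taken to be $h_j$ when $f_{+j}g_j=0$), $\mathfrak{c}_{\pm j}=\dfrac{1-b_j^2\pm2\sqrt{b_j^4+b_j^2+1}}{b_j^2-1}$. ''$\mu=\mathfrak{c}_{\pm j}\frac{\lambda}{3}$'' means that equality holds for one of the two signs; ''$\mu\neq\mathfrak{c}_{\pm j}\frac\lambda3$''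 means it holds for neither. For $(c_1,c_2,t_1,t_2)\in\Bbbk^4$ with $c_1c_2=g_j$, $t_1t_2=f_{+j}$, $c_1t_1+c_2t_2=h_j$ (and $3\mu\ne\lambda$), $N_j(c_1,c_2,t_1,t_2)$ is the module with basis $x,y,v_1,v_2,w_1,w_2$, where $\langle x\rangle\simeq S_j^+$, $\langle y\rangle\simeq S_j^-$, and each $\{v_i,w_i\}$ ($i=1,2$) is a basis of a copy of $M_j$ with $sv_i=\xi v_i$, $sw_i=\xi^2w_i$, $tv_i=w_i$, $tw_i=\zeta^jv_i$, and $$[a_0]=\begin{pmatrix}0&c_2&f&0&-bf&0\\ c_1&0&0&-f&0&-bf\\ -b&0&0&t_1&0&b(c_2-t_1)\\ 0&b&t_2&0&b(t_2-c_1)&0\\ 1&0&0&(t_1-c_2)/b&0&-t_1\\ 0&1&(c_1-t_2)/b&0&-t_2&0\end{pmatrix}.$$ If $\mu=-2\frac{\lambda}{3}$ and $b_j^2=-1$, set $N_j^{(1)}=N_j(0,0,1,-\lambda/3)$. Otherwise set $N_j^{(1)}=N_j(1,g_j,\mathfrak{s}_j,f_{+j}/\mathfrak{s}_j)$ and $N_j^{(2)}=N_j(g_j,1,f_{+j}/\mathfrak{s}_j,\mathfrak{s}_j)$.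
   Formalization: In (3)(b) the uniqueness of j is taken as a hypothesis: the condition holds for j and ℓ−j together, and if ℓ−j≠j then N_{ℓ-j}^{(1)}≅N_{ℓ-j}^{(2)}, so the stated list and count 2ℓ+3 fail (e.g. ℓ=3, μ=−λ/3≠0). *)

(* Defs.v *)
From HB Require Import structures.
From mathcomp Require Import all_boot all_order all_algebra.
From Stdlib Require List.

Set Implicit Arguments.
Unset Strict Implicit.
Unset Printing Implicit Defensive.

Import GRing.Theory.
Local Open Scope ring_scope.

(* A finite-dimensional left module over an algebra given by generators and
   relations is a vector space with one operator per generator such that the
   relations hold.  The operators are recorded first; [is_Gmodule] and
   [is_Amodule] state the relations. *)

Record Gops (k : closedFieldType) := GOps {
  Gspace :> vectType k;
  op_s : 'End(Gspace);
  op_t : 'End(Gspace)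
}.

(* [Ares M] is the restriction of [M] to the group; the index set of
   a_0, a_1, a_2 is the additive group 'Z_3. *)
Record Aops (k : closedFieldType) := AOps {
  Ares :> Gops k;
  op_a : 'Z_3 -> 'End(Ares)
}.

Section Modules.

Variable k : closedFieldType.

Definition is_Gmodule (l : nat) (M : Gops k) : Prop :=
  let s := op_s M in let t := op_t M in
  [/\ forall v, s (s (s v)) = v,
      forall v, iter (2 * l) t v = v
    & forall v, t (s v) = s (s (t v))].

Definition is_Amodule (l : nat) (lam mu : k) (M : Aops k) : Prop :=
  let s := op_s M in let t := op_t M in let a := op_a M in
  [/\ is_Gmodule l M,
      forall i v, t (a i v) = - a (- i) (t v)
      /\ s (a i v) = a (i + 1) (s v),
      forall i v, a i (a i v) = mu *: (v - t (t v)),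
      forall v, a 0 (a 1 v) + a 1 (a 2 v) + a 2 (a 0 v)
                = lam *: (v - s (t (t v)))
    & forall v, a 1 (a 0 v) + a 2 (a 1 v) + a 0 (a 2 v)
                = lam *: (v - s (s (t (t v))))].

Definition submodule (M : Aops k) (U : {vspace M}) : Prop :=
  [/\ (op_s M @: U <= U)%VS,
      (op_t M @: U <= U)%VS
    & forall i, (op_a M i @: U <= U)%VS].

Definition is_simple (M : Aops k) : Prop :=
  (fullv : {vspace M}) <> 0%VS
  /\ forall U : {vspace M}, submodule U -> U = 0%VS \/ U = fullv.

Definition isomorphic (M N : Aops k) : Prop :=
  exists phi : 'Hom(M, N),
    [/\ bijective phi,
        forall v, phi (op_s M v) = op_s N (phi v),
        forall v, phi (op_t M v) = op_t N (phi v)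
      & forall i v, phi (op_a M i v) = op_a N i (phi v)].

Definition simple_modules_are (l : nat) (lam mu : k)
    (Ms : seq (Aops k)) (n : nat) : Prop :=
  [/\ size Ms = n,
      List.Forall (fun M => is_Amodule l lam mu M /\ is_simple M) Ms,
      List.ForallOrdPairs (fun M N => ~ isomorphic M N) Ms
    & forall M, is_Amodule l lam mu M -> is_simple M ->
        List.Exists (isomorphic M) Ms].

Definition mx_rows n (rows : seq (seq k)) : 'M[k]_n :=
  \matrix_(i, j) nth 0 (nth [::] rows i) j.

(* Matrices act on column vectors, so that the columns of a matrix are the
   images of the basis vectors. *)
Definition mx_op n (X : 'M[k]_n) : 'End('cV[k]_n) := linfun (mulmx X).

Definition mx_Gops n (S T : 'M[k]_n) : Gops k := GOps (mx_op S) (mx_op T).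

(* The algebra is generated by a_0, s, t: the relation s a_i = a_(i+1) s and
   s^3 = 1 give a_1 = s a_0 s^2 and a_2 = s^2 a_0 s. *)
Definition extend (M : Gops k) (a0 : 'End(M)) : Aops k :=
  let s := op_s M in
  @AOps k M (fun i => nth a0 [:: a0; s \o a0 \o s \o s; s \o s \o a0 \o s]%VF i).

Definition zero_ext (M : Gops k) : Aops k := extend (0 : 'End(M)).

Definition diag_rows n (d : seq k) : 'M[k]_n := diag_mx (\row_i nth 0 d i).

Section Families.

Variables (xi zeta : k) (b : nat -> k).

Definition Splus (j : nat) : Gops k :=
  mx_Gops (1%:M : 'M_1) (b j)%:M.

Definition Sminus (j : nat) : Gops k :=
  mx_Gops (1%:M : 'M_1) (- b j)%:M.

Definition Mtwo (j : nat) : Gops k :=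
  mx_Gops (diag_rows 2 [:: xi; xi ^+ 2])
          (mx_rows 2 [:: [:: 0; zeta ^+ j];
                         [:: 1; 0       ]]).

Definition Lmod (j : nat) (a c : k) : Aops k :=
  @extend (Mtwo j)
    (mx_op (mx_rows 2 [:: [:: a; - (zeta ^+ j * c)];
                          [:: c; - a              ]])).

Definition SplusSminus (j : nat) : Gops k :=
  mx_Gops (1%:M : 'M_2) (diag_rows 2 [:: b j; - b j]).

Variables lam mu : k.

Definition Tmod (j : nat) : Aops k :=
  @extend (SplusSminus j)
    (mx_op (mx_rows 2 [:: [:: 0; mu * (1 - zeta ^+ j)];
                          [:: 1; 0                   ]])).

Definition f_ (j : nat) : k :=
  (lam - 3 * mu) * (1 - zeta ^+ j) / (9 * b j).

Definition g_ (j : nat) : k :=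
  (3 * mu + 2 * lam) * (1 - zeta ^+ j) / 9.

Definition fplus (j : nat) : k :=
  mu / 3 * (1 - zeta ^+ j) + lam / 9 * (2 + zeta ^+ j).

Definition h_ (j : nat) : k :=
  lam / 9 * (5 + b j ^+ 2) + mu / 3 * (1 - b j ^+ 2).

(* [d j] stands for a square root of h_j^2 - 4 f_(+j) g_j. *)
Definition s_ (d : nat -> k) (j : nat) : k := (h_ j + d j) / 2.

(* [q] stands for a square root of b_j^4 + b_j^2 + 1; the two signs in
   c_(+-j) correspond to [q] and [- q]. *)
Definition c_ (q : k) (j : nat) : k :=
  (1 - b j ^+ 2 + 2 * q) / (b j ^+ 2 - 1).

Definition mu_is_c (q : nat -> k) (j : nat) : Prop :=
  mu = c_ (q j) j * (lam / 3) \/ mu = c_ (- q j) j * (lam / 3).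

(* The basis is x, y, v_1, v_2, w_1, w_2. *)
Definition Nres (j : nat) : Gops k :=
  let B := b j in let z := zeta ^+ j in
  mx_Gops
    (diag_rows 6 [:: 1; 1; xi; xi; xi ^+ 2; xi ^+ 2])
    (mx_rows 6 [:: [:: B; 0  ; 0; 0; 0; 0];
                   [:: 0; - B; 0; 0; 0; 0];
                   [:: 0; 0  ; 0; 0; z; 0];
                   [:: 0; 0  ; 0; 0; 0; z];
                   [:: 0; 0  ; 1; 0; 0; 0];
                   [:: 0; 0  ; 0; 1; 0; 0]]).

Definition Nmod (j : nat) (c1 c2 t1 t2 : k) : Aops k :=
  let B := b j in let f := f_ j in
  @extend (Nres j) (mx_op (mx_rows 6
    [:: [:: 0  ; c2; f            ; 0            ; - (B * f)    ; 0            ];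
        [:: c1 ; 0 ; 0            ; - f          ; 0            ; - (B * f)    ];
        [:: - B; 0 ; 0            ; t1           ; 0            ; B * (c2 - t1)];
        [:: 0  ; B ; t2           ; 0            ; B * (t2 - c1); 0            ];
        [:: 1  ; 0 ; 0            ; (t1 - c2) / B; 0            ; - t1         ];
        [:: 0  ; 1 ; (c1 - t2) / B; 0            ; - t2         ; 0            ]])).

Variable d : nat -> k.

Definition N1 (j : nat) : Aops k :=
  if (mu == - 2 * (lam / 3)) && (b j ^+ 2 == -1)
  then Nmod j 0 0 1 (- (lam / 3))
  else Nmod j 1 (g_ j) (s_ d j) (fplus j / s_ d j).

(* Not meant for the exceptional case in the definition of [N1], where
   s_j = 0 and N_j^(2) is not defined. *)
Definition N2 (j : nat) : Aops k :=
  Nmod j (g_ j) 1 (fplus j / s_ d j) (s_ d j).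

End Families.

Definition four_L (xi zeta : k) (j : nat) (r : k) : seq (Aops k) :=
  [seq Lmod xi zeta j ac.1 ac.2
     | ac <- [:: (r, r); (r, - r); (- r, r); (- r, - r)]].

End Modules.

(* Main.v *)
From HB Require Import structures.
Require Import Defs.
From mathcomp Require Import all_boot all_order all_algebra.
From mathcomp Require Import ring.
From Stdlib Require List.

Set Implicit Arguments.
Unset Strict Implicit.
Unset Printing Implicit Defensive.

Import GRing.Theory.
Local Open Scope ring_scope.

(** Put p, q, r for the Fourier components of a_0, a_1, a_2 under conjugation
by s, so that a_i = p + xi^i q + xi^(-i) r.  If V_m is the eigenspace of s for
xi^m, then p preserves V_m, q maps V_m to V_(m+1) and r maps V_m to V_(m-1).
The quadratic relations turn into pq + qp + r^2 = 0, pr + rp + q^2 = 0 and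
three formulas that express p^2, qr and rq through s and t^2.  Since t^2 is
central it is a scalar z = zeta^j on a simple module, and then p^2, qr, rq are
explicit scalars on every V_m ([gr0], [gr1], [gr2]); on V_0 both qr and rq are
phi = (mu - lam/3)(1 - z)/3.

If phi <> 0, then q and r identify V_1 and V_2 with V_0, so everything is
encoded on V_0 by t, p and P = phi^(-1) r p q.  These satisfy the relations of
a Clifford algebra: t anticommutes with p and P, and t^2 = z, p^2 = g,
P^2 = f_+, pP + Pp = - h ([clifford], [rpq_rpq]).  Hence Pp has an eigenvector
x in the b-eigenspace of t, with eigenvalue - s or s - h
([phi_eigenvector]); x and one more vector of V_0 ([six_partner]) generate a
copy of N^(1) or N^(2).

If phi = 0, then c = q^3 = r^3 on V_0 has square 0 and anticommutes with t and
p.  If V_0 <> 0, its kernel K in V_0 is thus nonzero, the subspace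
qK + rK + q^2 K + r^2 K is a submodule that misses V_0, so it vanishes, and
the vectors of V_0 killed by q and r form a nonzero submodule
([degenerate_V0]): only p and t act, and the module is S_j^(+-) or T_j.
If V_0 = 0, then p and tq commute on V_1, and a common eigenvector together
with its image under t spans some L_j(a,c).

In all cases the module contains a vector v satisfying an explicit list of
equations ([generates]).  In bases adapted to the grading the listed modules
have operators with one nonzero entry per column, so the equations satisfied
by v give a homomorphism from the matching listed module, which is bijective
by Schur's lemma.  The same equations tell the listed modules apart
([generates_inj]).

Finally h^2 - 4 f_+ g is, up to a constant factor, a polynomial in z = zeta^j
whose zeros are stable under z -> 1/z, and mu = c_(+-j) lam/3 says exactly
that it vanishes.  So uniqueness of such a j forces zeta^j = -1 and, as
mu <> 0, mu = -2 lam/3 ([unique_exceptional]); this is the parameter value at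
which s_j = 0 and where the two modules attached to j collapse into one. *)

(** * Linear identities in a vector space *)

(** Equality of vectors can be tested on coordinates.  Stating this with an
abstract coordinate function keeps rewriting purely syntactic; it reduces an
identity between vectors to one between scalars. *)
Lemma eq_scalars (k : fieldType) (V : vectType k) (u v : V) :
  (forall c : V -> k,
     [/\ forall x y, c (x + y) = c x + c y, forall x, c (- x) = - c x,
         forall a x, c (a *: x) = a * c x & c 0 = 0] -> c u = c v) -> u = v.
Proof.
move=> uv; rewrite (coord_vbasis (memvf u)) (coord_vbasis (memvf v)).
apply: eq_bigr => i _; congr (_ *: _); apply: uv.
by split=> *; rewrite ?linearD ?linearN ?linearZ ?linear0.
Qed.

Section Linearity.

Variables (k : fieldType) (U V : vectType k) (f : 'Hom(U, V)).

Lemma lfD u v : f (u + v) = f u + f v. Proof. exact: linearD. Qed.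
Lemma lfN u : f (- u) = - f u. Proof. exact: linearN. Qed.
Lemma lfZ a u : f (a *: u) = a *: f u. Proof. exact: linearZ. Qed.
Lemma lf0 : f 0 = 0. Proof. exact: linear0. Qed.

End Linearity.

(** Distributes linear maps over vector expressions; the redexes are matched
syntactically because unification up to conversion is very slow on them. *)
Ltac expand :=
  repeat match goal with
  | |- context [fun_of_lfun ?f (?x + ?y)] => rewrite (lfD f x y)
  | |- context [fun_of_lfun ?f (- ?x)] => rewrite (lfN f x)
  | |- context [fun_of_lfun ?f (?a *: ?x)] => rewrite (lfZ f a x)
  | |- context [fun_of_lfun ?f 0] => rewrite (lf0 f)
  end.

(** Turns an identity between linear combinations of vectors into an identity
in the field of scalars, with one unknown per vector. *)
Ltac coords :=
  expand; apply: eq_scalars;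
  let c := fresh "c" in let cD := fresh "cD" in let cN := fresh "cN" in
  let cZ := fresh "cZ" in let c0 := fresh "c0" in
  intros c [cD cN cZ c0];
  repeat match goal with
  | |- context [c (?x + ?y)] => rewrite (cD x y)
  | |- context [c (- ?x)] => rewrite (cN x)
  | |- context [c (?a *: ?x)] => rewrite (cZ a x)
  | |- context [c 0] => rewrite c0
  end.
Ltac vect := coords; ring.

(** * Fourier components of the generators *)

Lemma natr_neq0 (k : fieldType) (char0 : [pchar k] =i pred0) n :
  n.+1%:R != 0 :> k.
Proof. by move/pcharf0P: char0 => ->. Qed.

Section Fourier.

Variables (k : fieldType) (n3 : 3 != 0 :> k).
Variables (xi : k) (xi2 : xi ^+ 2 = - 1 - xi) (lam mu : k).
Variable V : vectType k.
Implicit Types (s t a p q r : 'End(V)) (v : V).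

Record a_rel s t a0 a1 a2 v : Prop := ARel {
  arel_s3 : s (s (s v)) = v;
  arel_ts : t (s v) = s (s (t v));
  arel_s0 : s (a0 v) = a1 (s v);
  arel_s1 : s (a1 v) = a2 (s v);
  arel_s2 : s (a2 v) = a0 (s v);
  arel_t0 : t (a0 v) = - a0 (t v);
  arel_t1 : t (a1 v) = - a2 (t v);
  arel_t2 : t (a2 v) = - a1 (t v);
  arel_00 : a0 (a0 v) = mu *: (v - t (t v));
  arel_11 : a1 (a1 v) = mu *: (v - t (t v));
  arel_22 : a2 (a2 v) = mu *: (v - t (t v));
  arel_01 : a0 (a1 v) + a1 (a2 v) + a2 (a0 v) = lam *: (v - s (t (t v)));
  arel_10 : a1 (a0 v) + a2 (a1 v) + a0 (a2 v) = lam *: (v - s (s (t (t v))))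
}.

(** The defining relations after the Fourier transform, at a single vector:
being linear in [v], they need only be checked on a basis.  The last three are
the inverse transform of the three relations with right-hand sides in the
group algebra. *)
Record pqr_rel s t p q r v : Prop := PqrRel {
  rel_s3 : s (s (s v)) = v;
  rel_ts : t (s v) = s (s (t v));
  rel_sp : s (p v) = p (s v);
  rel_sq : s (q v) = xi *: q (s v);
  rel_sr : s (r v) = xi ^+ 2 *: r (s v);
  rel_tp : t (p v) = - p (t v);
  rel_tq : t (q v) = - r (t v);
  rel_tr : t (r v) = - q (t v);
  rel_pq : p (q v) = - q (p v) - r (r v);
  rel_pr : p (r v) = - r (p v) - q (q v);
  rel_pp : p (p v) = 3^-1 *: (mu *: (v - t (t v))
    + (lam / 3) *: (v - s (t (t v))) + (lam / 3) *: (v - s (s (t (t v)))));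
  rel_qr : q (r v) = 3^-1 *: (mu *: (v - t (t v))
    + (xi * lam / 3) *: (v - s (t (t v)))
    + (xi ^+ 2 * lam / 3) *: (v - s (s (t (t v)))));
  rel_rq : r (q v) = 3^-1 *: (mu *: (v - t (t v))
    + (xi ^+ 2 * lam / 3) *: (v - s (t (t v)))
    + (xi * lam / 3) *: (v - s (s (t (t v)))))
}.

(** For c = 1, xi, xi^2 these are the components p, q, r. *)
Definition fourier_op c a0 a1 a2 : 'End(V) :=
  3^-1 *: (a0 + c ^+ 2 *: a1 + c *: a2).

Lemma pqr_rel_of_a s t a0 a1 a2 v :
  (forall v, a_rel s t a0 a1 a2 v) ->
  pqr_rel s t (fourier_op 1 a0 a1 a2) (fourier_op xi a0 a1 a2)
    (fourier_op (xi ^+ 2) a0 a1 a2) v.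
Proof.
move=> A.
have s0 u := arel_s0 (A u); have s1 u := arel_s1 (A u).
have s2 u := arel_s2 (A u); have t0 u := arel_t0 (A u).
have t1 u := arel_t1 (A u); have t2 u := arel_t2 (A u).
have aa0 := arel_00 (A v); have aa1 := arel_11 (A v).
have aa2 := arel_22 (A v).
have e20 : a2 (a0 v) = lam *: (v - s (t (t v))) - a0 (a1 v) - a1 (a2 v).
  by rewrite -(arel_01 (A v)); vect.
have e02 : a0 (a2 v) = lam *: (v - s (s (t (t v)))) - a1 (a0 v) - a2 (a1 v).
  by rewrite -(arel_10 (A v)); vect.
split; [exact: arel_s3 (A v) | exact: arel_ts (A v) | ..];
  rewrite /fourier_op !(scale_lfunE, add_lfunE); expand;
  rewrite ?(t0, t1, t2, s0, s1, s2) ?aa0 ?aa1 ?aa2 ?e20 ?e02; coords;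
  by field: xi2.
Qed.

Lemma a_rel_of_pqr s t a0 a1 a2 p q r v :
  (forall v, [/\ a0 v = p v + q v + r v,
                 a1 v = p v + xi *: q v + xi ^+ 2 *: r v
               & a2 v = p v + xi ^+ 2 *: q v + xi *: r v]) ->
  pqr_rel s t p q r v -> a_rel s t a0 a1 a2 v.
Proof.
move=> aE [s3 ts sp sq sr tp tq tr pq pr pp qr rq].
have a0E u : a0 u = p u + q u + r u by have [] := aE u.
have a1E u : a1 u = p u + xi *: q u + xi ^+ 2 *: r u by have [] := aE u.
have a2E u : a2 u = p u + xi ^+ 2 *: q u + xi *: r u by have [] := aE u.
split; [exact: s3 | exact: ts | ..]; rewrite ?(a0E, a1E, a2E); expand;
  rewrite ?(sp, sq, sr, tp, tq, tr, pq, pr) ?(a0E, a1E, a2E); expand;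
  rewrite ?(pq, pr, pp, qr, rq); coords; by field: xi2.
Qed.

Lemma pqr_rel_lin s t p q r (c : k) u v :
  pqr_rel s t p q r u -> pqr_rel s t p q r v -> pqr_rel s t p q r (c *: u + v).
Proof.
move=> [s3 ts sp sq sr tp tq tr pq pr pp qr rq]
  [s3' ts' sp' sq' sr' tp' tq' tr' pq' pr' pp' qr' rq'].
by split; expand;
  rewrite ?(s3, ts, sp, sq, sr, tp, tq, tr, pq, pr, pp, qr, rq)
    ?(s3', ts', sp', sq', sr', tp', tq', tr', pq', pr', pp', qr', rq');
  vect.
Qed.

End Fourier.

Section Presentation.

Variables (k : closedFieldType) (l : nat) (lam mu : k) (M : Aops k).

Lemma Z3_cases (i : 'Z_3) : [\/ i = 0, i = 1 | i = 2].
Proof.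
case: i => -[|[|[|//]]] i; [apply: Or31|apply: Or32|apply: Or33]; exact: val_inj.
Qed.

Lemma is_AmoduleP :
  is_Amodule l lam mu M <->
  (forall v, iter (2 * l) (op_t M) v = v) /\
  (forall v, a_rel lam mu (op_s M) (op_t M) (op_a M 0) (op_a M 1) (op_a M 2) v).
Proof.
have e1 : - (1 : 'Z_3) = 2 by exact: val_inj.
have e2 : - (2 : 'Z_3) = 1 by exact: val_inj.
have e3 : 1 + 1 = 2 :> 'Z_3 by exact: val_inj.
have e4 : 2 + 1 = 0 :> 'Z_3 by exact: val_inj.
split.
  case=> -[s3 tl ts] ta aa aa1 aa2; split; first exact: tl.
  move=> v; have [[[t0 s0] [t1 s1]] [t2 s2]] := (ta 0 v, ta 1 v, ta 2 v).
  rewrite oppr0 add0r e1 e2 e3 e4 in t0 t1 t2 s0 s1 s2.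
  by split; first [exact: s3 | exact: ts | exact: t0 | exact: t1 | exact: t2
    | exact: s0 | exact: s1 | exact: s2 | exact: aa | exact: aa1 | exact: aa2].
case=> tl A; split.
- by split=> [v||v]; [exact: arel_s3 (A v) | exact: tl | exact: arel_ts (A v)].
- move=> i v; have [_ _ s0 s1 s2 t0 t1 t2 _ _ _ _ _] := A v.
  by case: (Z3_cases i) => ->; rewrite ?(oppr0, add0r, e1, e2, e3, e4).
- move=> i v; have [_ _ _ _ _ _ _ _ a0 a1 a2 _ _] := A v.
  by case: (Z3_cases i) => ->.
- by move=> v; exact: arel_01 (A v).
- by move=> v; exact: arel_10 (A v).
Qed.

End Presentation.

(** * Homomorphisms and submodules in terms of p, q, r *)

Section Components.

Variables (k : closedFieldType) (n3 : 3 != 0 :> k).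
Variables (xi : k) (xi2 : xi ^+ 2 = - 1 - xi).
Implicit Types M N : Aops k.

Definition p_op M := fourier_op 1 (op_a M 0) (op_a M 1) (op_a M 2).
Definition q_op M := fourier_op xi (op_a M 0) (op_a M 1) (op_a M 2).
Definition r_op M := fourier_op (xi ^+ 2) (op_a M 0) (op_a M 1) (op_a M 2).

Lemma op_aE M : [/\ forall v, op_a M 0 v = p_op M v + q_op M v + r_op M v,
   forall v, op_a M 1 v = p_op M v + xi *: q_op M v + xi ^+ 2 *: r_op M v
 & forall v, op_a M 2 v = p_op M v + xi ^+ 2 *: q_op M v + xi *: r_op M v].
Proof.
rewrite /p_op /q_op /r_op /fourier_op; split=> v;
  rewrite !(scale_lfunE, add_lfunE); coords; by field: xi2.
Qed.

Lemma fourier_opK M (p q r : 'End(M)) :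
  (forall v, [/\ op_a M 0 v = p v + q v + r v,
                 op_a M 1 v = p v + xi *: q v + xi ^+ 2 *: r v
               & op_a M 2 v = p v + xi ^+ 2 *: q v + xi *: r v]) ->
  [/\ p_op M = p, q_op M = q & r_op M = r].
Proof.
move=> aE; have aE0 v : op_a M 0 v = p v + q v + r v by have [] := aE v.
have aE1 v : op_a M 1 v = p v + xi *: q v + xi ^+ 2 *: r v by have [] := aE v.
have aE2 v : op_a M 2 v = p v + xi ^+ 2 *: q v + xi *: r v by have [] := aE v.
by split; apply/lfunP=> v; rewrite /p_op /q_op /r_op /fourier_op
  !(scale_lfunE, add_lfunE) aE0 aE1 aE2; coords; field: xi2.
Qed.

Definition stable M (U : {vspace M}) :=
  forall v, v \in U -> [/\ op_s M v \in U, op_t M v \in U, p_op M v \in U,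
                           q_op M v \in U & r_op M v \in U].

Lemma stableP M (U : {vspace M}) : submodule U <-> stable U.
Proof.
split.
  case=> /subvP sU /subvP tU aU v Uv.
  have aUv i : op_a M i v \in U.
    by have /subvP := aU i; apply; exact: memv_img.
  by split; [apply: sU | apply: tU | ..]; rewrite ?memv_img // scale_lfunE
    !add_lfunE ?scale_lfunE memvZ ?memvD ?memvZ.
move=> sU; split; last move=> i; apply/subvP=> _ /memv_imgP[v /sU[s t p q r] ->]//.
by have [a0 a1 a2] := op_aE M; case: (Z3_cases i) => ->; rewrite ?(a0, a1, a2) !memvD ?memvZ.
Qed.

Definition intertwines M N (f : 'Hom(M, N)) :=
  [/\ forall v, f (op_s M v) = op_s N (f v),
      forall v, f (op_t M v) = op_t N (f v)
    & forall i v, f (op_a M i v) = op_a N i (f v)].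

Lemma intertwines_pqr M N (f : 'Hom(M, N)) :
  intertwines f ->
  [/\ forall v, f (p_op M v) = p_op N (f v), forall v, f (q_op M v) = q_op N (f v)
    & forall v, f (r_op M v) = r_op N (f v)].
Proof.
case=> _ _ fa; split=> v; rewrite /p_op /q_op /r_op /fourier_op;
  by rewrite !(scale_lfunE, add_lfunE) -!fa !(lfD, lfZ).
Qed.

Lemma intertwines_of_pqr M N (f : 'Hom(M, N)) :
  (forall v, f (op_s M v) = op_s N (f v)) ->
  (forall v, f (op_t M v) = op_t N (f v)) ->
  (forall v, f (p_op M v) = p_op N (f v)) ->
  (forall v, f (q_op M v) = q_op N (f v)) ->
  (forall v, f (r_op M v) = r_op N (f v)) -> intertwines f.
Proof.
move=> fs ft fp fq fr; split=> // i v.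
have [a0 a1 a2] := op_aE M; have [b0 b1 b2] := op_aE N.
by case: (Z3_cases i) => ->; rewrite ?(a0, a1, a2, b0, b1, b2) !(lfD, lfZ) fp fq fr.
Qed.

(** Schur's lemma: kernel and image of an intertwiner are submodules. *)
Lemma isomorphic_of_simple M N (f : 'Hom(M, N)) v :
  is_simple M -> is_simple N -> intertwines f -> f v <> 0 -> isomorphic N M.
Proof.
move=> [_ sM] [_ sN] fMN fv; have [fs ft fa] := fMN.
have [fp fq fr] := intertwines_pqr fMN.
have kerf : lker f = 0%VS.
  have [|//|kf] := sM (lker f).
    apply/stableP=> u; rewrite !memv_ker fs ft fp fq fr => /eqP ->.
    by rewrite !lf0 eqxx.
  by case: fv; apply/eqP; rewrite -memv_ker kf memvf.
have imf : limg f = fullv.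
  have [|imf0|//] := sN (limg f).
    apply/stableP=> _ /memv_imgP[u _ ->].
    by rewrite -fs -ft -fp -fq -fr !memv_img ?memvf.
  by case: fv; apply/eqP; rewrite -memv0 -imf0 memv_img ?memvf.
have fK : cancel f f^-1%VF by apply/lker0_lfunK/eqP.
have fVK w : f (f^-1%VF w) = w by rewrite limg_lfunVK // imf memvf.
exists f^-1%VF; split; first by exists f.
- by move=> w; rewrite -{1}[w]fVK -fs fK.
- by move=> w; rewrite -{1}[w]fVK -ft fK.
- by move=> i w; rewrite -{1}[w]fVK -fa fK.
Qed.

End Components.

(** * Modules given by monomial matrices *)

Section Monomial.

Variables (k : closedFieldType) (n3 : 3 != 0 :> k).
Variables (xi : k) (xi2 : xi ^+ 2 = - 1 - xi).

(** A table lists, for each basis vector, the index of the basis vector to which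
its image is proportional, and the factor.  Beyond its end, a table describes
the zero operator. *)
Definition table := seq (nat * k).
Definition entry (T : table) i : nat * k := nth (0%N, 0) T i.

(** [deg] is the dimension minus one. *)
Record monomial := Monomial {
  deg : nat; s_tab : table; t_tab : table;
  p_tab : table; q_tab : table; r_tab : table
}.

Definition follows (V : vectType k) (e : nat -> V) (X : 'End(V)) (T : table) i :=
  X (e i) = (entry T i).2 *: e (entry T i).1.

(** Both a basis of the monomial module and a suitable family of vectors in an
arbitrary module can satisfy [D]; comparing the two gives homomorphisms. *)
Definition satisfies (D : monomial) (M : Aops k) (e : nat -> M) :=
  forall i, (i <= deg D)%N ->
  [/\ follows e (op_s M) (s_tab D) i, follows e (op_t M) (t_tab D) i,
      follows e (p_op M) (p_tab D) i, follows e (q_op xi M) (q_tab D) i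
    & follows e (r_op xi M) (r_tab D) i].

Definition within n (T : table) := all (fun x : nat * k => x.1 <= n)%N T.
Definition well_formed D :=
  all (within (deg D)) [:: s_tab D; t_tab D; p_tab D; q_tab D; r_tab D].

Definition tab_mx n (T : table) : 'M[k]_n :=
  \matrix_(i, j) (if i == (entry T j).1 :> nat
                  then (entry T j).2 else 0).

Definition unit_vec n i : 'cV[k]_n.+1 := delta_mx (inord i) 0.

Lemma tab_mxE n T i : (i <= n)%N -> within n T ->
  follows (@unit_vec n) (mx_op (tab_mx n.+1 T)) T i.
Proof.
move=> lein wT; rewrite /follows lfunE /=.
have lejn : ((entry T i).1 <= n)%N.
  rewrite /entry; case: (ltnP i (size T)) => [iT|/(nth_default _) -> //].
  exact/(allP wT)/mem_nth.
rewrite -colE; apply/colP=> j; rewrite !mxE eqxx andbT inordK //.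
by rewrite -val_eqE /= inordK //; case: eqP; rewrite ?mulr1 ?mulr0.
Qed.

Definition monomial_module D : Aops k :=
  @extend _ (mx_Gops (tab_mx (deg D).+1 (s_tab D)) (tab_mx (deg D).+1 (t_tab D)))
    (mx_op (tab_mx (deg D).+1 (p_tab D) + tab_mx (deg D).+1 (q_tab D)
            + tab_mx (deg D).+1 (r_tab D))).

Lemma unit_vec_span n (v : 'cV[k]_n.+1) :
  v = \sum_(i < n.+1) v i 0 *: unit_vec n i.
Proof.
rewrite {1}[v]matrix_sum_delta; apply: eq_bigr => i _.
by rewrite big_ord1 /unit_vec inord_val.
Qed.

Section Model.

Variables (lam mu z : k) (D : monomial) (wD : well_formed D).
Let n := deg D.
Let s := mx_op (tab_mx n.+1 (s_tab D)).
Let t := mx_op (tab_mx n.+1 (t_tab D)).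
Let p := mx_op (tab_mx n.+1 (p_tab D)).
Let q := mx_op (tab_mx n.+1 (q_tab D)).
Let r := mx_op (tab_mx n.+1 (r_tab D)).

Hypothesis rel : forall i, (i <= n)%N ->
  pqr_rel xi lam mu s t p q r (unit_vec n i).

Let rel_all v : pqr_rel xi lam mu s t p q r v.
Proof.
rewrite [v]unit_vec_span; elim/big_rec: _ => [|i u _ IH].
  have := pqr_rel_lin (- 1) (rel (leq0n n)) (rel (leq0n n)).
  by rewrite scaleN1r addNr.
by apply: pqr_rel_lin => //; apply: rel; rewrite -ltnS.
Qed.

Lemma monomial_module_a (v : monomial_module D) :
  [/\ op_a (monomial_module D) 0 v = p v + q v + r v,
      op_a (monomial_module D) 1 v = p v + xi *: q v + xi ^+ 2 *: r v
    & op_a (monomial_module D) 2 v = p v + xi ^+ 2 *: q v + xi *: r v].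
Proof.
have a0E (u : 'cV_n.+1) : mx_op (tab_mx n.+1 (p_tab D) + tab_mx n.+1 (q_tab D)
            + tab_mx n.+1 (r_tab D)) u = p u + q u + r u.
  by rewrite !lfunE /= !mulmxDl.
have s3 u := rel_s3 (rel_all u); have sp u := rel_sp (rel_all u).
have sq u := rel_sq (rel_all u); have sr u := rel_sr (rel_all u).
split; rewrite /= ?comp_lfunE.
- exact: a0E.
- by rewrite a0E !lfD sp sq sr s3.
- rewrite a0E !lfD sp sq sr; expand; rewrite sp sq sr s3; coords.
  by ring: xi2.
Qed.

Lemma monomial_module_pqr :
  [/\ p_op (monomial_module D) = p, q_op xi (monomial_module D) = q & r_op xi (monomial_module D) = r].
Proof. exact/fourier_opK/monomial_module_a. Qed.

Lemma monomial_module_satisfies : @satisfies D (monomial_module D) (unit_vec n).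
Proof.
have [pE qE rE] := monomial_module_pqr.
have /and5P[ws wt wp wq /andP[wr _]] := wD.
by move=> i lein; rewrite pE qE rE; split; exact: tab_mxE.
Qed.

Lemma monomial_module_is_Amodule l :
  z ^+ l = 1 -> (forall i, (i <= n)%N -> t (t (unit_vec n i)) = z *: unit_vec n i) ->
  is_Amodule l lam mu (monomial_module D).
Proof.
move=> zl tz; apply/is_AmoduleP; split=> v.
  have ttv u : t (t u) = z *: u.
    rewrite [u]unit_vec_span; elim/big_rec: _ => [|i w _ IH].
      by rewrite !lf0 scaler0.
    by rewrite !(lfD, lfZ) IH tz ?scalerDr ?scalerA 1?mulrC // -ltnS.
  suff it m : iter (2 * m) t v = z ^+ m *: v by rewrite [LHS]it zl scale1r.
  elim: m => [|m IHm]; first by rewrite scale1r.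
  by rewrite mulnS iterD IHm /= ttv scalerA exprS.
exact: (a_rel_of_pqr n3 xi2 monomial_module_a (rel_all v)).
Qed.

End Model.

End Monomial.

(* Unification must not unfold the components: only their relations matter. *)
#[global] Opaque p_op q_op r_op.

Section Homs.

Variables (k : closedFieldType) (n3 : 3 != 0 :> k).
Variables (xi : k) (xi2 : xi ^+ 2 = - 1 - xi).

Lemma unit_vec_hom (V : vectType k) n (e : nat -> V) :
  exists f : 'Hom('cV[k]_n.+1, V),
    forall i, (i <= n)%N -> f (unit_vec k n i) = e i.
Proof.
pose g (v : 'cV[k]_n.+1) := \sum_(i < n.+1) v i 0 *: e i.
have g_lin : linear g.
  move=> a u v; rewrite /g scaler_sumr -big_split; apply: eq_bigr => i _ /=.
  by rewrite !mxE scalerDl scalerA.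
pose G : {linear 'cV[k]_n.+1 -> V} :=
  HB.pack g (GRing.isLinear.Build k _ _ _ g g_lin).
exists (linfun G) => i lein; rewrite lfunE /= /g (bigD1 (inord i)) //= big1.
  by rewrite mxE !eqxx scale1r addr0 inordK.
by move=> j /negPf ne; rewrite mxE ne scale0r.
Qed.

(** The linear map sending the basis of the monomial module to [e] is an
intertwiner, since on basis vectors both sides are read off the same table. *)
Lemma hom_of_satisfies (D : monomial k) (M : Aops k) (e : nat -> M) :
  well_formed D -> satisfies xi D (M := monomial_module D) (unit_vec k (deg D)) ->
  satisfies xi D e ->
  exists2 f : 'Hom(monomial_module D, M), intertwines f &
    forall i, (i <= deg D)%N -> f (unit_vec k (deg D) i) = e i.
Proof.
move=> /and5P[ws wt wp wq /andP[wr _]] satD satM.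
have [f fE] := unit_vec_hom (deg D) e.
have comm (X : 'End(monomial_module D)) (Y : 'End(M)) T : within (deg D) T ->
    (forall i, (i <= deg D)%N -> follows (unit_vec k (deg D)) X T i) ->
    (forall i, (i <= deg D)%N -> follows e Y T i) ->
    forall v, f (X v) = Y (f v).
  move=> wT XE YE v; rewrite [v]unit_vec_span.
  elim/big_rec: _ => [|i u _ IH]; first by rewrite !lf0.
  rewrite !(lfD, lfZ) IH; congr (_ *: _ + _).
  have lein : (i <= deg D)%N by rewrite -ltnS.
  rewrite (XE i lein) lfZ !fE // ?(YE i lein) //.
  by rewrite /entry; case: (ltnP i (size T)) => [iT|/(nth_default _) -> //];
    apply/(allP wT)/mem_nth.
exists f => //; apply: (intertwines_of_pqr n3 xi2);
  [apply: comm ws _ _ | apply: comm wt _ _ | apply: comm wp _ _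
  | apply: comm wq _ _ | apply: comm wr _ _] => i lein;
  by have [] := satD i lein; have [] := satM i lein.
Qed.

End Homs.

(** * The four families of monomial data *)

Section Data.

Variables (k : closedFieldType) (lam mu z : k).

(** The scalars by which p^2, qr and rq act on the spaces V_m when t^2 = z:
on V_0 they are gg, phi, phi, on V_1 they are ff, phi, psi, and on V_2 they are
ff, psi, phi.  At z = zeta^j, [gg], [ff] and [hh] are g_j, f_(+j) and h_j. *)
Definition phi := (mu - lam / 3) * (1 - z) / 3.
Definition psi := phi - lam / 3 * z.
Definition gg := (3 * mu + 2 * lam) * (1 - z) / 9.
Definition ff := mu / 3 * (1 - z) + lam / 9 * (2 + z).
Definition hh := lam / 9 * (5 + z) + mu / 3 * (1 - z).

(** The modules S_j^(+-) with a_0 = 0. *)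
Definition line (b : k) := Monomial 0 [:: (0%N, 1)] [:: (0%N, b)] [::] [::] [::].

(** The modules L_j(a,c), with z = zeta^j. *)
Definition plane (xi a c : k) := Monomial 1
  [:: (0%N, xi); (1%N, xi ^+ 2)] [:: (1%N, 1); (0%N, z)]
  [:: (0%N, a); (1%N, - a)] [:: (1%N, c); (0%N, 0)] [:: (0%N, 0); (0%N, - (z * c))].

(** The modules T_j. *)
Definition tee (b g : k) := Monomial 1
  [:: (0%N, 1); (1%N, 1)] [:: (0%N, b); (1%N, - b)]
  [:: (1%N, 1); (0%N, g)] [::] [::].

(** The modules N_j(c_1,c_2,t_1,t_2) in the basis x, y, v_1, v_2, w_1, w_2.
The entries of [a_0] that preserve, raise or lower the s-degree are its
components p, q, r; each of them is monomial. *)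
Definition six (xi b f c1 c2 t1 t2 : k) := Monomial 5
  [:: (0%N, 1); (1%N, 1); (2%N, xi); (3%N, xi); (4%N, xi ^+ 2); (5%N, xi ^+ 2)]
  [:: (0%N, b); (1%N, - b); (4%N, 1); (5%N, 1); (2%N, z); (3%N, z)]
  [:: (1%N, c1); (0%N, c2); (3%N, t2); (2%N, t1); (5%N, - t2); (4%N, - t1)]
  [:: (2%N, - b); (3%N, b); (5%N, (c1 - t2) / b); (4%N, (t1 - c2) / b);
      (0%N, - (b * f)); (1%N, - (b * f))]
  [:: (4%N, 1); (5%N, 1); (0%N, f); (1%N, - f);
      (3%N, b * (t2 - c1)); (2%N, b * (c2 - t1))].

End Data.

Section Checks.

Variables (k : closedFieldType) (n3 : 3 != 0 :> k).
Variables (xi : k) (xi2 : xi ^+ 2 = - 1 - xi) (lam mu : k).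
Variables (V : vectType k) (e : nat -> V) (s t p q r : 'End(V)).

Definition obeys (D : monomial k) := forall i, (i <= deg D)%N ->
  [/\ follows e s (s_tab D) i, follows e t (t_tab D) i,
      follows e p (p_tab D) i, follows e q (q_tab D) i
    & follows e r (r_tab D) i].

Lemma line_rel (z b : k) : b ^+ 2 = z -> mu * z = mu -> lam * z = lam ->
  obeys (line b) -> forall i, (i <= 0)%N -> pqr_rel xi lam mu s t p q r (e i).
Proof.
move=> <- {z} mz lz ob; have [s0 t0 p0 q0 r0] := ob 0%N isT.
rewrite /follows /entry /= in s0 t0 p0 q0 r0.
have zero c : c * b ^+ 2 = c -> c = 0 \/ b ^+ 2 = 1.
  move=> cb; have : c * (b ^+ 2 - 1) == 0 by rewrite mulrBr cb mulr1 subrr.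
  by rewrite mulf_eq0 => /orP[/eqP|]; [left | rewrite subr_eq0 => /eqP; right].
move=> [|//] _; split; do 6? (rewrite ?(s0, t0, p0, q0, r0); expand); coords;
  case: (zero _ mz) => [m0|b2]; case: (zero _ lz) => [l0|{}b2];
  rewrite ?m0 ?l0; by first [ring | field: b2].
Qed.

Lemma tee_rel (z b : k) : b ^+ 2 = z -> phi lam mu z = 0 ->
  obeys (tee b (gg lam mu z)) ->
  forall i, (i <= 1)%N -> pqr_rel xi lam mu s t p q r (e i).
Proof.
have n9 : 9 != 0 :> k by rewrite (_ : 9 = 3 * 3) ?mulf_neq0 //; ring.
move=> <- {z} ph ob.
have mz : mu * b ^+ 2 = mu - lam / 3 * (1 - b ^+ 2).
  move: ph => /(congr1 ( *%R 3)); rewrite /phi mulr0 => ph.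
  by apply/eqP; rewrite -subr_eq0 -oppr_eq0 -[X in _ == X]ph; apply/eqP; field.
have [s0 t0 p0 q0 r0] := ob 0%N isT; have [s1 t1 p1 q1 r1] := ob 1%N isT.
rewrite /follows /entry /gg /= in s0 s1 t0 t1 p0 p1 q0 q1 r0 r1.
have lamE : lam = 3 * (lam / 3) by rewrite mulrC divfK.
move: (lam / 3) lamE mz p1 => w -> mz p1.
move=> i; do 2?[case: i => [|i] //] => _; split;
  do 6? (rewrite ?(s0, s1, t0, t1, p0, p1, q0, q1, r0, r1); expand); coords;
  first [ring | field: xi2 mz]; by rewrite ?n3 ?n9.
Qed.

Lemma plane_rel (z a c : k) : phi lam mu z = 0 ->
  a ^+ 2 = lam / 3 -> c ^+ 2 = lam / 3 -> obeys (plane z xi a c) ->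
  forall i, (i <= 1)%N -> pqr_rel xi lam mu s t p q r (e i).
Proof.
move=> ph a2 c2 ob; have lamE : lam = 3 * (lam / 3) by rewrite mulrC divfK.
have mz : mu * z = mu - lam / 3 * (1 - z).
  move: ph => /(congr1 ( *%R 3)); rewrite /phi mulr0 => ph.
  by apply/eqP; rewrite -subr_eq0 -oppr_eq0 -[X in _ == X]ph; apply/eqP; field.
have [s0 t0 p0 q0 r0] := ob 0%N isT; have [s1 t1 p1 q1 r1] := ob 1%N isT.
rewrite /follows /entry /= in s0 s1 t0 t1 p0 p1 q0 q1 r0 r1.
move: (lam / 3) lamE mz a2 c2 => w -> mz a2 c2.
move=> i; do 2?[case: i => [|i] //] => _; split;
  do 6? (rewrite ?(s0, s1, t0, t1, p0, p1, q0, q1, r0, r1); expand); coords;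
  by first [ring | field: xi2 mz a2 c2].
Qed.

End Checks.

Section SixCheck.

Variables (k : closedFieldType) (n3 : 3 != 0 :> k).
Variables (xi : k) (xi2 : xi ^+ 2 = - 1 - xi) (lam mu : k).
Variables (V : vectType k) (e : nat -> V) (s t p q r : 'End(V)).

(** The constraints on the parameters are those of N_j.  Each relation at each
basis vector is a consequence of one of them, or of one of the combinations
[ku] and [kr] below. *)
Lemma six_rel (z b c1 c2 t1 t2 : k) : b != 0 -> b ^+ 2 = z ->
  c1 * c2 = gg lam mu z -> t1 * t2 = ff lam mu z ->
  c1 * t1 = hh lam mu z - c2 * t2 ->
  obeys e s t p q r (six z xi b (- phi lam mu z / b) c1 c2 t1 t2) ->
  forall i, (i <= 5)%N -> pqr_rel xi lam mu s t p q r (e i).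
Proof.
move=> b0 <-; rewrite /gg /ff /hh /phi => cc tt ct ob.
have n9 : 9 != 0 :> k by rewrite (_ : 9 = 3 * 3) ?mulf_neq0 //; ring.
(* This substitution makes all the scalars polynomial in L and m. *)
have [L lamE] : exists L, lam = 9 * L by exists (lam / 9); rewrite mulrC divfK.
have [m muE] : exists m, mu = 3 * m by exists (mu / 3); rewrite mulrC divfK.
rewrite {}lamE {}muE in cc tt ct ob *.
have {}cc : c1 * c2 = (m + 2 * L) * (1 - b ^+ 2) by rewrite cc; field.
have {}tt : t1 * t2 = m * (1 - b ^+ 2) + L * (2 + b ^+ 2).
  by rewrite tt; field; rewrite n9 n3.
have {}ct : c1 * t1 = L * (5 + b ^+ 2) + m * (1 - b ^+ 2) - c2 * t2.
  by rewrite ct; field; rewrite n9 n3.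
have ku : c1 * t1 = t1 * t2 + c1 * c2 - c2 * t2
    - ((m - L) * (1 - b ^+ 2) - 3 * L * b ^+ 2).
  by rewrite ct cc tt; ring.
have kr : c1 * t1 = 2 * (t1 * t2) - c2 * t2 - (m - L) * (1 - b ^+ 2).
  by rewrite ct tt; ring.
have [s0 t0 p0 q0 r0] := ob 0%N isT; have [s1 t1' p1 q1 r1] := ob 1%N isT.
have [s2 t2' p2 q2 r2] := ob 2%N isT; have [s3 t3 p3 q3 r3] := ob 3%N isT.
have [s4 t4 p4 q4 r4] := ob 4%N isT; have [s5 t5 p5 q5 r5] := ob 5%N isT.
rewrite /follows /entry /= in s0 s1 s2 s3 s4 s5 t0 t1' t2' t3 t4 t5 p0 p1 p2
  p3 p4 p5 q0 q1 q2 q3 q4 q5 r0 r1 r2 r3 r4 r5.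
move=> i; do 6?[case: i => [|i] //] => _; split.
all: do 6? (rewrite ?(s0, s1, s2, s3, s4, s5, t0, t1', t2', t3, t4, t5, p0, p1, p2,
  p3, p4, p5, q0, q1, q2, q3, q4, q5, r0, r1, r2, r3, r4, r5); expand).
all: coords.
all: first [field: xi2 | field: xi2 cc | field: xi2 tt | field: xi2 ku
  | field: xi2 kr]; by rewrite ?b0 ?n3.
Qed.

End SixCheck.

(** * The relations on the eigenspaces of s *)

(** Indeed ff - gg = z lam/3 and ff - phi = lam/3, so phi = 0 follows from
gg = ff = 0. *)
Lemma gg_ff_neq0 (k : closedFieldType) (n3 : 3 != 0 :> k) (lam mu z : k) :
  z != 0 -> phi lam mu z != 0 -> gg lam mu z != 0 \/ ff lam mu z != 0.
Proof.
move=> z0 phi0; have n9 : 9 != 0 :> k by rewrite (_ : 9 = 3 * 3) ?mulf_neq0 //; ring.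
have [g0|] := eqVneq (gg lam mu z) 0; last by left.
right; apply: contra phi0 => /eqP f0.
have l0 : lam / 3 * z = ff lam mu z - gg lam mu z.
  by rewrite /ff /gg; field; rewrite n3 n9.
have -> : phi lam mu z = ff lam mu z - lam / 3 * z / z.
  by rewrite /phi /ff; field; rewrite ?z0 ?n3 ?n9.
by rewrite l0 f0 g0 subrr mul0r subrr.
Qed.

Section Graded.

Variables (k : closedFieldType) (n3 : 3 != 0 :> k).
Variables (xi : k) (xi2 : xi ^+ 2 = - 1 - xi) (lam mu z : k).
Variables (V : vectType k) (s t p q r : 'End(V)).
Hypothesis rel : forall v, pqr_rel xi lam mu s t p q r v.
Hypothesis tz : forall v, t (t v) = z *: v.

Local Notation phi := (phi lam mu z).
Local Notation psi := (psi lam mu z).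
Local Notation gg := (gg lam mu z).
Local Notation ff := (ff lam mu z).
Local Notation hh := (hh lam mu z).

Let n9 : 9 != 0 :> k.
Proof. by rewrite (_ : 9 = 3 * 3) ?mulf_neq0 //; ring. Qed.

Lemma xi3 : xi ^+ 3 = 1.
Proof. by ring: xi2. Qed.

Lemma gr_s3 v : s (s (s v)) = v. Proof. exact: rel_s3 (rel v). Qed.
Lemma gr_sp v : s (p v) = p (s v). Proof. exact: rel_sp (rel v). Qed.
Lemma gr_sq v : s (q v) = xi *: q (s v). Proof. exact: rel_sq (rel v). Qed.
Lemma gr_sr v : s (r v) = xi ^+ 2 *: r (s v). Proof. exact: rel_sr (rel v). Qed.
Lemma gr_tp v : t (p v) = - p (t v). Proof. exact: rel_tp (rel v). Qed.
Lemma gr_tq v : t (q v) = - r (t v). Proof. exact: rel_tq (rel v). Qed.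
Lemma gr_tr v : t (r v) = - q (t v). Proof. exact: rel_tr (rel v). Qed.
Lemma gr_pq v : p (q v) = - q (p v) - r (r v). Proof. exact: rel_pq (rel v). Qed.
Lemma gr_pr v : p (r v) = - r (p v) - q (q v). Proof. exact: rel_pr (rel v). Qed.

Lemma gr_st v : s (t v) = t (s (s v)).
Proof.
have ts u : t (s u) = s (s (t u)) by exact: rel_ts (rel u).
by rewrite !ts !gr_s3.
Qed.

Lemma gr0 v : s v = v ->
  [/\ p (p v) = gg *: v, q (r v) = phi *: v & r (q v) = phi *: v].
Proof.
move=> sv; have [_ _ _ _ _ _ _ _ _ _ -> -> ->] := rel v.
rewrite !tz; expand; rewrite !sv /gg /phi.
by split; coords; field: xi2; rewrite ?n3 ?n9.
Qed.

Lemma gr1 v : s v = xi *: v ->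
  [/\ p (p v) = ff *: v, q (r v) = phi *: v & r (q v) = psi *: v].
Proof.
move=> sv; have [_ _ _ _ _ _ _ _ _ _ -> -> ->] := rel v.
rewrite !tz; expand; rewrite !sv; expand; rewrite !sv /ff /psi /phi.
by split; coords; field: xi2; rewrite ?n3 ?n9.
Qed.

Lemma gr2 v : s v = xi ^+ 2 *: v ->
  [/\ p (p v) = ff *: v, q (r v) = psi *: v & r (q v) = phi *: v].
Proof.
move=> sv; have [_ _ _ _ _ _ _ _ _ _ -> -> ->] := rel v.
rewrite !tz; expand; rewrite !sv; expand; rewrite !sv /ff /psi /phi.
by split; coords; field: xi2; rewrite ?n3 ?n9.
Qed.

Lemma pp0 v : s v = v -> p (p v) = gg *: v. Proof. by case/gr0. Qed.
Lemma qr0 v : s v = v -> q (r v) = phi *: v. Proof. by case/gr0. Qed.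
Lemma rq0 v : s v = v -> r (q v) = phi *: v. Proof. by case/gr0. Qed.
Lemma pp1 v : s v = xi *: v -> p (p v) = ff *: v. Proof. by case/gr1. Qed.
Lemma qr1 v : s v = xi *: v -> q (r v) = phi *: v. Proof. by case/gr1. Qed.
Lemma rq1 v : s v = xi *: v -> r (q v) = psi *: v. Proof. by case/gr1. Qed.
Lemma pp2 v : s v = xi ^+ 2 *: v -> p (p v) = ff *: v. Proof. by case/gr2. Qed.
Lemma qr2 v : s v = xi ^+ 2 *: v -> q (r v) = psi *: v. Proof. by case/gr2. Qed.

Lemma s0p v : s v = v -> s (p v) = p v. Proof. by rewrite gr_sp => ->. Qed.
Lemma s0q v : s v = v -> s (q v) = xi *: q v. Proof. by rewrite gr_sq => ->. Qed.
Lemma s0r v : s v = v -> s (r v) = xi ^+ 2 *: r v. Proof. by rewrite gr_sr => ->. Qed.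
Lemma s0t v : s v = v -> s (t v) = t v. Proof. by move=> sv; rewrite gr_st !sv. Qed.
Lemma s1p v : s v = xi *: v -> s (p v) = xi *: p v.
Proof. by rewrite gr_sp => ->; rewrite lfZ. Qed.
Lemma s1q v : s v = xi *: v -> s (q v) = xi ^+ 2 *: q v.
Proof. by rewrite gr_sq => ->; rewrite lfZ scalerA. Qed.
Lemma s1r v : s v = xi *: v -> s (r v) = r v.
Proof. by rewrite gr_sr => ->; rewrite lfZ scalerA -exprSr xi3 scale1r. Qed.
Lemma s1t v : s v = xi *: v -> s (t v) = xi ^+ 2 *: t v.
Proof. by move=> sv; rewrite gr_st sv !lfZ sv !lfZ scalerA. Qed.
Lemma s2q v : s v = xi ^+ 2 *: v -> s (q v) = q v.
Proof. by rewrite gr_sq => ->; rewrite lfZ scalerA -exprS xi3 scale1r. Qed.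
Lemma s2r v : s v = xi ^+ 2 *: v -> s (r v) = xi *: r v.
Proof.
by rewrite gr_sr => ->; rewrite lfZ scalerA -exprD exprSr xi3 mul1r.
Qed.
Lemma s2t v : s v = xi ^+ 2 *: v -> s (t v) = xi *: t v.
Proof.
rewrite gr_st => sv; rewrite sv !lfZ sv !lfZ scalerA.
by rewrite -exprD exprSr xi3 mul1r.
Qed.

(** Evaluate p(q(rv)) by the relation for pq and replace p(rv) by the
relation for pr; on V_0 both qr and rq are the same scalar. *)
Lemma qqq_rrr v : s v = v -> q (q (q v)) = r (r (r v)).
Proof.
move=> sv; have := gr_pq (r v); rewrite qr0 // gr_pr; expand.
rewrite qr0 ?s0p //; set X := phi *: p v => e.
transitivity (- (- X - q (q (q v))) - r (r (r v)) - X + r (r (r v))).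
  by vect.
by rewrite -e; vect.
Qed.

(** So P can be defined through V_1 or through V_2, which is what makes it
anticommute with t. *)
Lemma rpq_qpr v : s v = v -> r (p (q v)) = q (p (r v)).
Proof.
move=> sv; rewrite gr_pq gr_pr; expand.
by rewrite rq0 ?qr0 ?s0p // qqq_rrr.
Qed.

Lemma t_rpq v : s v = v -> t (r (p (q v))) = - r (p (q (t v))).
Proof.
by move=> sv; rewrite rpq_qpr // gr_tq gr_tp gr_tr; vect.
Qed.

(** For P = phi^(-1) rpq this says P^2 = ff. *)
Lemma rpq_rpq v : s v = v -> r (p (q (r (p (q v))))) = (phi ^+ 2 * ff) *: v.
Proof.
move=> sv; rewrite qr1 ?s1p ?s0q //; expand.
by rewrite pp1 ?s0q //; expand; rewrite rq0 // !scalerA; congr (_ *: _); ring.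
Qed.

(** For P = phi^(-1) rpq this says Pp + pP = - hh. *)
Lemma clifford v : s v = v ->
  r (p (q (p v))) + p (r (p (q v))) = - (phi * hh) *: v.
Proof.
move=> sv.
have qq : q (q v) = - r (p v) - p (r v) by rewrite gr_pr; vect.
(* Rewriting q^2 v by the relation for pr leaves p^2 on V_2, a scalar. *)
have qpq : q (p (q v)) = ff *: r v + p (r (p v)) - phi *: r v.
  have -> : q (p (q v)) = - p (q (q v)) - r (r (q v)) by rewrite (gr_pq (q v)); vect.
  by rewrite qq rq0 //; expand; rewrite pp2 ?s0r //; vect.
rewrite (gr_pr (p (q v))) pp1 ?s0q // qpq; expand.
rewrite qr0 // rq0 // -rpq_qpr ?s0p //; coords.
by rewrite /hh /ff /phi; field; rewrite n3 n9.
Qed.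

(** The Clifford relations give (Pp)^2 = - hh Pp - ff gg. *)
Lemma clifford_quad v : s v = v -> let K w := r (p (q (p w))) in
  K (K v) = - (phi * hh) *: K v - (phi ^+ 2 * ff * gg) *: v.
Proof.
move=> sv /=; have := clifford (s0p sv); rewrite pp0 //; expand => e.
have -> : p (r (p (q (p v)))) = - (phi * hh) *: p v - gg *: r (p (q v)).
  by rewrite -e; vect.
by expand; rewrite rpq_rpq // !scalerA; congr (_ - _ *: _); ring.
Qed.

End Graded.

(** * Existence of eigenvectors *)

Section Eigenvectors.

Variables (k : fieldType) (V : vectType k).

(** Provides an eigenvector for one of the roots: either v is an eigenvector
for a, or the vector below is a nonzero eigenvector for c. *)
Lemma quad_root (f : 'End(V)) v a c :
  f (f v) = (a + c) *: f v - (a * c) *: v ->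
  f (f v - a *: v) = c *: (f v - a *: v).
Proof. by move=> e; expand; rewrite e; vect. Qed.

(** The sums [u j] are eigenvectors, and they add up to l v. *)
Lemma root_of_unity_eigenvector l (zeta : k) (f : 'End(V)) v :
  (0 < l)%N -> l%:R != 0 :> k -> l.-primitive_root zeta ->
  iter l f v = v -> v != 0 ->
  exists j u, [/\ (j < l)%N, u != 0 & f u = zeta ^+ j *: u].
Proof.
move=> l0 ln0 zl fl v0.
pose u j := \sum_(i < l) zeta ^+ (j * (l - i)) *: iter i f v.
have fu j : f (u j) = zeta ^+ j *: u j.
  rewrite /u linear_sum scaler_sumr /=; case: l l0 ln0 zl fl @u => // l _ _ zl fl _.
  rewrite big_ord_recr big_ord_recl /= addrC; congr (_ + _).
    rewrite lfZ -[f _]/(iter l.+1 f v) fl subSn // subnn muln1 subn0.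
    by rewrite scalerA mulnC exprM (prim_expr_order zl) expr1n mulr1.
  apply: eq_bigr => i _; rewrite lfZ scalerA -exprD /bump /= add1n subSS.
  by rewrite -mulnS subSn // ltnW.
have sum_u : \sum_(j < l) u j = l%:R *: v.
  rewrite exchange_big /= (bigD1 (Ordinal l0)) //= [X in _ + X]big1 ?addr0.
    rewrite -scaler_suml subn0; congr (_ *: _).
    rewrite (eq_bigr (fun=> 1)) ?sumr_const ?card_ord // => j _.
    by rewrite mulnC exprM (prim_expr_order zl) expr1n.
  move=> i i0; rewrite -scaler_suml; set m := (l - i)%N.
  have /negPf zm : zeta ^+ m != 1.
    rewrite -(prim_order_dvd zl) gtnNdvd ?subn_gt0 // /m ltn_subrL l0 andbT.
    by rewrite lt0n; apply: contra i0 => /eqP i0; apply/eqP/val_inj.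
  have /eqP := subrX1 (zeta ^+ m) l.
  rewrite -exprM mulnC exprM (prim_expr_order zl) expr1n subrr eq_sym mulf_eq0.
  rewrite subr_eq0 zm /= => /eqP sum0.
  rewrite (eq_bigr (fun j : 'I_l => (zeta ^+ m) ^+ j)) ?sum0 ?scale0r // => j _.
  by rewrite -exprM mulnC.
case: (pickP (fun j : 'I_l => u j != 0)) => [j uj|u0].
  by exists j, (u j).
have /eqP : l%:R *: v = 0.
  by rewrite -sum_u big1 // => j _; have /negbFE/eqP := u0 j.
by rewrite scaler_eq0 (negPf ln0) (negPf v0).
Qed.

End Eigenvectors.

(** * Distinguished vectors in simple modules *)

Section Simple.

Variables (k : closedFieldType) (n3 : 3 != 0 :> k).
Variables (xi : k) (xi2 : xi ^+ 2 = - 1 - xi) (lam mu z : k) (z0 : z != 0).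
Variable M : Aops k.
Let s := op_s M.
Let t := op_t M.
Let p := p_op M.
Let q := q_op xi M.
Let r := r_op xi M.
Hypothesis rel : forall v, pqr_rel xi lam mu s t p q r v.
Hypothesis tz : forall v, t (t v) = z *: v.
Hypothesis simple : is_simple M.

Local Notation phi := (phi lam mu z).
Local Notation psi := (psi lam mu z).
Local Notation gg := (gg lam mu z).
Local Notation ff := (ff lam mu z).
Local Notation hh := (hh lam mu z).

Local Notation sp := (gr_sp rel).
Local Notation tp := (gr_tp rel).
Local Notation tq := (gr_tq rel).
Local Notation tr := (gr_tr rel).
Local Notation pq := (gr_pq rel).
Local Notation pr := (gr_pr rel).

Lemma simple_full (U : {vspace M}) v :
  stable xi U -> v \in U -> v != 0 -> forall u, u \in U.
Proof.
move=> stU Uv v0 u; have [_ /(_ U) [|U0|->]] := simple; last exact: memvf.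
  exact/(stableP n3 xi2).
by rewrite U0 memv0 (negPf v0) in Uv.
Qed.

Lemma simple_nonzero : exists v : M, v != 0.
Proof.
exists (vpick fullv); rewrite vpick0; apply/eqP; exact: (proj1 simple).
Qed.

Lemma t_inj v : v != 0 -> t v != 0.
Proof.
by apply: contra => /eqP tv; move: (tz v); rewrite tv lf0 => /esym/eqP;
  rewrite scaler_eq0 (negPf z0).
Qed.

(** The projections of v to V_0, V_1 and V_2 add up to 3v, and t exchanges V_1
and V_2. *)
Lemma grade_cases (U : {vspace M}) v : stable xi U -> v \in U -> v != 0 ->
  (exists w, [/\ w \in U, w != 0 & s w = w]) \/
  (exists w, [/\ w \in U, w != 0 & s w = xi *: w]).
Proof.
move=> stU Uv v0.
(* Three times the projection of v to V_i. *)
pose e i := v + xi ^+ (2 * i) *: s v + xi ^+ i *: s (s v).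
have se i : s (e i) = xi ^+ i *: e i.
  have x3 : xi ^+ i ^+ 3 = 1 by rewrite -exprM mulnC exprM xi3 // expr1n.
  rewrite /e; expand; rewrite (gr_s3 rel) mulnC exprM; coords.
  by ring: x3.
have Us w : w \in U -> s w \in U by case/stU.
have Ue i : e i \in U by rewrite /e !memvD ?memvZ ?Us.
have [e0|ne0] := eqVneq (e 0%N) 0; last first.
  by left; exists (e 0%N); rewrite se scale1r.
have [e1|ne1] := eqVneq (e 1%N) 0; last by right; exists (e 1%N).
have [e2|ne2] := eqVneq (e 2%N) 0; last first.
  right; exists (t (e 2%N)); rewrite t_inj //; split=> //.
    by have [] := stU _ (Ue 2%N).
  by apply: (s2t xi2 rel); rewrite se.
case/eqP: v0.
have : 3 *: v = e 0%N + e 1%N + e 2%N by rewrite /e; coords; ring: xi2.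
by rewrite e0 e1 e2 !addr0 => /eqP; rewrite scaler_eq0 (negPf n3) => /eqP.
Qed.

Lemma full_cases :
  (exists2 w, w != 0 & s w = w) \/ (exists2 w, w != 0 & s w = xi *: w).
Proof.
have [u u0] := simple_nonzero.
have stF : stable xi (fullv : {vspace M}) by move=> v _; rewrite !memvf.
by have [[w [_ w0 sw]]|[w [_ w0 sw]]] := grade_cases stF (memvf u) u0;
  [left | right]; exists w.
Qed.

Section Invertible.

Variables (b sig : k).
Hypotheses (b2 : b ^+ 2 = z) (phi0 : phi != 0).
Hypothesis sig_root : sig * (hh - sig) = ff * gg.

(** A nonzero vector of V_0 exists because r is injective on V_1.  If t acts on
it by - b, then p or rpq, whichever is injective, moves it to the b-eigenspace
of t.  This eigenspace is stable under K = rpqp, which satisfies a quadratic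
equation with roots - phi sig and - phi (hh - sig). *)
Lemma phi_eigenvector : exists x kappa : _, [/\ x != 0, s x = x, t x = b *: x,
  r (p (q (p x))) = - (phi * kappa) *: x & kappa = sig \/ kappa = hh - sig].
Proof.
have [v v0 sv] : exists2 v : M, v != 0 & s v = v.
  have [//|[w w0 sw]] := full_cases; exists (r w); last exact: (s1r xi2 rel sw).
  apply: contra w0 => /eqP rw; have := qr1 n3 xi2 rel tz sw.
  by rewrite -/r rw lf0 => /esym/eqP; rewrite scaler_eq0 (negPf phi0).
have [u [u0 su tu]] : exists u : M, [/\ u != 0, s u = u & t u = b *: u].
  have [tv|ntv] := eqVneq (t v + b *: v) 0; last first.
    exists (t v + b *: v); split=> //.
      by expand; rewrite (s0t rel sv) sv.
    by expand; rewrite tz -b2; vect.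
  have {}tv : t v = - b *: v by apply/eqP; rewrite scaleNr -addr_eq0 tv.
  have [g0|ng0] := eqVneq gg 0.
    have f0 : ff != 0 by case: (gg_ff_neq0 n3 z0 phi0); rewrite ?g0 ?eqxx.
    exists (r (p (q v))); split.
    - apply: contra v0 => /eqP e; have := rpq_rpq n3 xi2 rel tz sv.
      by rewrite -/p -/q -/r e !lf0 => /esym/eqP; rewrite scaler_eq0
        mulf_eq0 expf_eq0 (negPf phi0) (negPf f0).
    - by apply: (s1r xi2 rel); apply: (s1p rel); apply: (s0q rel).
    - by rewrite (t_rpq n3 xi2 rel tz sv) -/t tv; vect.
  exists (p v); split; last by rewrite tp -/t tv; vect.
  - apply: contra v0 => /eqP e; have := pp0 n3 xi2 rel tz sv.
    by rewrite -/p e lf0 => /esym/eqP; rewrite scaler_eq0 (negPf ng0).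
  - exact: (s0p rel sv).
pose K := (r \o p \o q \o p)%VF.
have KE w : K w = r (p (q (p w))) by rewrite !comp_lfunE.
have sK w : s w = w -> s (K w) = K w.
  move=> sw; rewrite KE; apply: (s1r xi2 rel); apply: (s1p rel).
  by apply: (s0q rel); apply: (s0p rel).
have tK : t (K u) = b *: K u.
  rewrite KE (t_rpq n3 xi2 rel tz (s0p rel su)) -/t tp tu; vect.
have KK : K (K u) = (- (phi * sig) + - (phi * (hh - sig))) *: K u
    - (- (phi * sig) * - (phi * (hh - sig))) *: u.
  rewrite !KE (clifford_quad n3 xi2 rel tz su) -/p -/q -/r.
  by congr (_ *: _ - _ *: _); [ring | rewrite [RHS]mulrNN [RHS]mulrACA sig_root; ring].
have := quad_root KK; set w := _ - _ => Kw.
have [w0|nw0] := eqVneq w 0.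
  exists u, sig; split=> //; last by left.
  by rewrite -KE; apply/eqP; rewrite -subr_eq0; apply/eqP.
exists w, (hh - sig); split=> //; last by right.
- by rewrite /w; expand; rewrite sK // su.
- by rewrite /w; expand; rewrite tK tu; vect.
- by rewrite -KE Kw.
Qed.

End Invertible.

Section Degenerate.

Lemma eq_opp_eq0 (U : zmodType) (u v : U) : u = - v -> u = 0 -> v = 0.
Proof. by move=> -> /eqP; rewrite oppr_eq0 => /eqP. Qed.

Hypothesis phi0 : phi = 0.

(** Together with [qqq_t] and [qqq_qqq]: the operator q^3 of V_0
anticommutes with p and t and has square 0. *)
Lemma qqq_p v : s v = v -> q (q (q (p v))) = - p (q (q (q v))).
Proof.
move=> sv; have spv := s0p rel sv.
have e1 : q (p (r (p v))) = - q (q (q (p v))).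
  by rewrite pr; expand; rewrite (qr0 n3 xi2 rel tz (s0p rel spv)) phi0; vect.
have e2 : p (q (q v)) = - p (r (p v)) - ff *: r v.
  have -> : q (q v) = - r (p v) - p (r v) by rewrite pr; vect.
  by expand; rewrite (pp2 n3 xi2 rel tz (s0r rel sv)).
have e3 : q (p (q (q v))) = q (q (q (p v))).
  by rewrite e2; expand; rewrite e1 (qr0 n3 xi2 rel tz sv) phi0; vect.
rewrite pq e3 (rq1 n3 xi2 rel tz (s0q rel sv)); expand.
by rewrite (rq0 n3 xi2 rel tz sv) phi0; vect.
Qed.

Lemma qqq_t v : s v = v -> q (q (q (t v))) = - t (q (q (q v))).
Proof.
by move=> sv; rewrite (qqq_rrr n3 xi2 rel tz sv) -/r tr tr tr; vect.
Qed.

Lemma qqq_qqq v : s v = v -> q (q (q (q (q (q v))))) = 0.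
Proof.
move=> sv; rewrite (qqq_rrr n3 xi2 rel tz sv) -/r.
rewrite (qr1 n3 xi2 rel tz (v := r (r v))) ?phi0 ?scale0r ?lf0 //.
exact: (s2r xi2 rel (s0r rel sv)).
Qed.

(** With K the kernel of q^3 in V_0, which is nonzero and stable under p and t,
the space W = qK + rK + q^2 K + r^2 K is a submodule.  Its vectors have no
component in V_0, so it is proper, hence zero; thus K is killed by q and r. *)
Lemma degenerate_V0 : (exists2 v, v != 0 & s v = v) ->
  forall v, [/\ s v = v, q v = 0 & r v = 0].
Proof.
case=> v1 v10 sv1.
pose K := (lker (s - \1%VF) :&: lker (q \o q \o q))%VS.
have memK v : (v \in K) = (s v == v) && (q (q (q v)) == 0).
  by rewrite memv_cap !memv_ker !comp_lfunE add_lfunE opp_lfunE id_lfunE subr_eq0.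
have K0 v : v \in K -> s v = v by rewrite memK => /andP[/eqP].
have Kq v : v \in K -> q (q (q v)) = 0 by rewrite memK => /andP[_ /eqP].
have Kr v : v \in K -> r (r (r v)) = 0.
  by move=> Kv; rewrite -(qqq_rrr n3 xi2 rel tz (K0 _ Kv)) Kq.
have Kt v : v \in K -> t v \in K.
  move=> Kv; rewrite memK (s0t rel (K0 _ Kv)) qqq_t ?K0 // Kq // lf0 oppr0.
  by rewrite !eqxx.
have Kp v : v \in K -> p v \in K.
  move=> Kv; rewrite memK (s0p rel (K0 _ Kv)) qqq_p ?K0 // Kq // lf0 oppr0.
  by rewrite !eqxx.
have [v Kv v0] : exists2 v, v \in K & v != 0.
  have [e|ne] := eqVneq (q (q (q v1))) 0.
    by exists v1 => //; rewrite memK sv1 e !eqxx.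
  exists (q (q (q v1))) => //; rewrite memK qqq_qqq // eqxx andbT.
  by apply/eqP/(s2q xi2 rel)/(s1q rel)/(s0q rel).
pose W := (q @: K + r @: K + (q \o q) @: K + (r \o r) @: K)%VS.
have memW w : reflect (exists a b c d, [/\ a \in K, b \in K, c \in K, d \in K &
    w = q a + r b + q (q c) + r (r d)]) (w \in W).
  apply: (iffP idP) => [|[a [b [c [d [Ka Kb Kc Kd ->]]]]]].
    case/memv_addP=> _ /memv_addP[_ /memv_addP[_ /memv_imgP[a Ka ->]
      [_ /memv_imgP[b Kb ->] ->]] [_ /memv_imgP[c Kc ->] ->]]
      [_ /memv_imgP[d Kd ->] ->].
    by exists a, b, c, d; split=> //; rewrite !comp_lfunE.
  by rewrite !memv_add ?memv_img // -comp_lfunE memv_img.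
have stW : stable xi W.
  move=> _ /memW[a [b [c [d [Ka Kb Kc Kd ->]]]]].
  have [[[sa sb] sc] sd] := (K0 _ Ka, K0 _ Kb, K0 _ Kc, K0 _ Kd).
  split; rewrite -/s -/t -/p -/q -/r; apply/memW.
  - exists (xi *: a), (xi ^+ 2 *: b), (xi ^+ 2 *: c), (xi *: d).
    rewrite !memvZ //; split=> //; expand.
    rewrite (s0q rel sa) (s0r rel sb) (s1q rel (s0q rel sc)).
    by rewrite (s2r xi2 rel (s0r rel sd)).
  - exists (- t b), (- t a), (t d), (t c).
    by rewrite !memvN !Kt //; split=> //; expand; rewrite !(tq, tr); expand;
      vect.
  - exists (- p a + (gg - ff) *: d), (- p b + (gg - ff) *: c),
      (p c - b), (p d - a).
    rewrite !(memvD, memvZ, memvN, Kp) //; split=> //.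
    have e1 : p (q (q c)) = (gg - ff) *: r c + q (q (p c)).
      have -> : q (q c) = - r (p c) - p (r c) by rewrite pr; vect.
      expand; rewrite (pp2 n3 xi2 rel tz (s0r rel sc)) pr.
      by rewrite (pp0 n3 xi2 rel tz sc); vect.
    have e2 : p (r (r d)) = (gg - ff) *: q d + r (r (p d)).
      have -> : r (r d) = - q (p d) - p (q d) by rewrite pq; vect.
      expand; rewrite (pp1 n3 xi2 rel tz (s0q rel sd)) pq.
      by rewrite (pp0 n3 xi2 rel tz sd); vect.
    by expand; rewrite e1 e2 pq pr; vect.
  - exists 0, (psi *: d), a, 0; rewrite !(mem0v, memvZ) //; split=> //; expand.
    rewrite (qr0 n3 xi2 rel tz sb) Kq //.
    by rewrite (qr2 n3 xi2 rel tz (s0r rel sd)) phi0; vect.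
  - exists (psi *: c), 0, 0, b; rewrite !(mem0v, memvZ) //; split=> //; expand.
    rewrite (rq0 n3 xi2 rel tz sa) Kr //.
    by rewrite (rq1 n3 xi2 rel tz (s0q rel sc)) phi0; vect.
(* 1 + s + s^2 is three times the projection to V_0. *)
have noW w : w \in W -> w + s w + s (s w) = 0.
  case/memW=> [a [b [c [d [Ka Kb Kc Kd ->]]]]].
  have [[[sa sb] sc] sd] := (K0 _ Ka, K0 _ Kb, K0 _ Kc, K0 _ Kd).
  have e1 u : s u = xi *: u -> u + s u + s (s u) = 0.
    by move=> su; rewrite su; expand; rewrite su; coords; ring: xi2.
  have e2 u : s u = xi ^+ 2 *: u -> u + s u + s (s u) = 0.
    by move=> su; rewrite su; expand; rewrite su; coords; ring: xi2.
  have E1 := e1 _ (s0q rel sa); have E2 := e2 _ (s0r rel sb).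
  have E3 := e2 _ (s1q rel (s0q rel sc)).
  have E4 := e1 _ (s2r xi2 rel (s0r rel sd)).
  rewrite -[RHS]addr0 -[RHS]addr0 -[RHS]addr0 -{1}E1 -{1}E2 -{1}E3 -E4.
  by vect.
have W0 w : w \in W -> w = 0.
  move=> Ww; apply/eqP/idPn => w0; have := noW _ (simple_full stW Ww w0 v).
  rewrite !K0 // => e; case/eqP: v0.
  have /eqP : 3 *: v = 0 by rewrite -e; vect.
  by rewrite scaler_eq0 (negPf n3) => /eqP.
pose U := (lker (s - \1%VF) :&: lker q :&: lker r)%VS.
have memU u : (u \in U) = [&& s u == u, q u == 0 & r u == 0].
  by rewrite !memv_cap !memv_ker add_lfunE opp_lfunE id_lfunE subr_eq0 andbA.
have stU : stable xi U.
  move=> u; rewrite memU => /and3P[/eqP su /eqP qu /eqP ru].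
  rewrite -/s -/t -/p -/q -/r; split.
  - by rewrite memU !su qu ru !eqxx.
  - rewrite memU (s0t rel su) eqxx /=; apply/andP; split; apply/eqP.
      by apply: (eq_opp_eq0 (tr u)); rewrite ru lf0.
    by apply: (eq_opp_eq0 (tq u)); rewrite qu lf0.
  - rewrite memU (s0p rel su) eqxx /=; apply/andP; split; apply/eqP.
      by apply: (@eq_opp_eq0 _ (p (q u))); [rewrite pq ru lf0 subr0 | rewrite qu lf0].
    by apply: (@eq_opp_eq0 _ (p (r u))); [rewrite pr qu lf0 subr0 | rewrite ru lf0].
  - by rewrite qu mem0v.
  - by rewrite ru mem0v.
have Uv : v \in U.
  have [z1 z2] : 0 \in K /\ 0 \in K by rewrite mem0v.
  rewrite memU K0 // eqxx /=; apply/andP; split; apply/eqP/W0/memW.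
    by exists v, 0, 0, 0; rewrite !lf0; split=> //; vect.
  by exists 0, v, 0, 0; rewrite !lf0; split=> //; vect.
move=> u; have := simple_full stU Uv v0 u.
by rewrite memU => /and3P[/eqP su /eqP qu /eqP ru].
Qed.

(** The three outcomes lead to S_j^(+-), T_j and L_j(a,c).  In the last one
V_0 = 0, so r = 0 on V_1; then m = tq satisfies m^2 = (z rho)^2 on V_1 and
commutes with p, while p^2 = rho^2. *)
Lemma degenerate_eigenvector (b rho : k) : b ^+ 2 = z -> rho ^+ 2 = lam / 3 ->
  [\/ gg = 0 /\ exists be v, [/\ be = b \/ be = - b, v != 0 &
        [/\ s v = v, t v = be *: v, p v = 0, q v = 0 & r v = 0]],
      gg != 0 /\ exists v, [/\ v != 0, t v = b *: v & forall u, [/\ s u = u, q u = 0 & r u = 0]]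
    | exists a c v, [/\ a = rho \/ a = - rho, c = rho \/ c = - rho, v != 0 &
        [/\ s v = xi *: v, p v = a *: v, q v = c *: t v & r v = 0]]].
Proof.
move=> b2 rho2.
have f_rho : ff = rho ^+ 2.
  have n9 : 9 != 0 :> k by rewrite (_ : 9 = 3 * 3) ?mulf_neq0 //; ring.
  have -> : ff = phi + lam / 3 by rewrite /ff /phi; field; rewrite n3 n9.
  by rewrite phi0 add0r.
have [V0|nV0] := eqVneq (lker (s - \1%VF)) 0%VS; last first.
  have [v v0 sv] : exists2 v : M, v != 0 & s v = v.
    exists (vpick (lker (s - \1%VF))); rewrite ?vpick0 //.
    by apply/eqP; have := memv_pick (lker (s - \1%VF));
      rewrite memv_ker add_lfunE opp_lfunE id_lfunE subr_eq0.
  have all0 : forall u, [/\ s u = u, q u = 0 & r u = 0].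
    by apply: degenerate_V0; exists v.
  have s0 u : s u = u by have [] := all0 u.
  have ppE u : p (p u) = gg *: u by exact: (pp0 n3 xi2 rel tz (s0 u)).
  have [g0|ng0] := eqVneq gg 0.
    apply: Or31; split=> //.
    have [w w0 pw] : exists2 w : M, w != 0 & p w = 0.
      have [pv|npv] := eqVneq (p v) 0; first by exists v.
      by exists (p v); rewrite // ppE g0 scale0r.
    have := @quad_root _ _ t w (- b) b; set u := t w - _ => tu.
    have {}tu : t u = b *: u by apply: tu; rewrite tz -b2; vect.
    have [u0|nu0] := eqVneq u 0.
      exists (- b), w; split=> //; first by right.
      have [_ qw rw] := all0 w; split=> //.
      by apply/eqP; rewrite -subr_eq0; apply/eqP.
    exists b, u; split=> //; first by left.
    have [_ qu ru] := all0 u; split=> //.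
    by rewrite /u; expand; rewrite pw (_ : p (t w) = 0) ?scaler0 ?subr0 //;
      apply: (eq_opp_eq0 (tp w)); rewrite pw lf0.
  apply: Or32; split=> //.
  have [tv|ntv] := eqVneq (t v + b *: v) 0; last first.
    by exists (t v + b *: v); split=> //; expand; rewrite tz -b2; vect.
  have {}tv : t v = - b *: v by apply/eqP; rewrite scaleNr -addr_eq0 tv.
  exists (p v); split=> //; last by rewrite tp tv; vect.
  apply: contra v0 => /eqP pv; move: (ppE v); rewrite pv lf0 => /esym/eqP.
  by rewrite scaler_eq0 (negPf ng0).
apply: Or33.
have noV0 u : s u = u -> u = 0.
  move=> su; apply/eqP; rewrite -memv0 -V0 memv_ker add_lfunE opp_lfunE.
  by rewrite id_lfunE su subrr.
have [v v0 sv] : exists2 v : M, v != 0 & s v = xi *: v.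
  have [[w w0 sw]|//] := full_cases.
  by rewrite (noV0 w sw) eqxx in w0.
have rV1 u : s u = xi *: u -> r u = 0 by move=> su; apply/noV0/(s1r xi2 rel su).
have [a [u [a_rho u0 su pu]]] : exists a u, [/\ a = rho \/ a = - rho, u != 0,
    s u = xi *: u & p u = a *: u].
  have := @quad_root _ _ p v (- rho) rho; set u := p v - _ => pu.
  have {}pu : p u = rho *: u.
    by apply: pu; rewrite (pp1 n3 xi2 rel tz sv) f_rho; vect.
  have [u0|nu0] := eqVneq u 0.
    exists (- rho), v; split=> //; first by right.
    by apply/eqP; rewrite -subr_eq0; apply/eqP.
  exists rho, u; split=> //; first by left.
  by rewrite /u; expand; rewrite (s1p rel sv) sv; vect.
pose m := (t \o q)%VF.
have mE w : m w = t (q w) by rewrite comp_lfunE.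
have mm : m (m u) = (- (z * rho) + z * rho) *: m u - (- (z * rho) * (z * rho)) *: u.
  have psi_rho : psi = - z * rho ^+ 2 by rewrite /psi phi0 -rho2; ring.
  rewrite !mE (_ : q (t (q u)) = - t (r (q u))); last by rewrite tr opprK.
  by rewrite (rq1 n3 xi2 rel tz su) psi_rho; expand; rewrite tz; vect.
have qm c w : m w = (z * c) *: w -> q w = c *: t w.
  move=> mw; apply: (scalerI z0); rewrite -tz -mE mw; vect.
have pm : p (m u) = a *: m u.
  rewrite mE (_ : p (t (q u)) = - t (p (q u))); last by rewrite tp opprK.
  by rewrite pq pu (rV1 u su) lf0; vect.
have sm : s (m u) = xi *: m u by rewrite mE; apply: (s2t xi2 rel (s1q rel su)).
have := quad_root mm; set w := _ - _ => mw.
have [w0|nw0] := eqVneq w 0.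
  exists a, (- rho), u; split=> //; first by right.
  split; rewrite ?rV1 //; apply: qm.
  by apply/eqP; rewrite mulrN -subr_eq0; apply/eqP.
have sw : s w = xi *: w by rewrite /w; expand; rewrite sm su; vect.
exists a, rho, w; split=> //; first by left.
split; rewrite ?rV1 //; last exact: qm.
by rewrite /w; expand; rewrite pm pu; vect.
Qed.

End Degenerate.

End Simple.

(** * The four families are modules *)

Section Models.

Variables (k : closedFieldType) (n2 : 2 != 0 :> k) (n3 : 3 != 0 :> k).
Variables (xi : k) (xi2 : xi ^+ 2 = - 1 - xi) (lam mu : k).

Lemma xi_neq1 : xi != 1.
Proof.
apply: contra n3 => /eqP xi1; have : 3 = xi ^+ 2 + xi + 1 by rewrite xi1; ring.
by rewrite xi2 => ->; apply/eqP; ring.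
Qed.

Lemma xi_neq0 : xi != 0.
Proof.
have := oner_neq0 k; rewrite -(xi3 xi2); apply: contra => /eqP ->.
by rewrite expr0n.
Qed.

Definition graded_by z (M : Aops k) :=
  (forall v, pqr_rel xi lam mu (op_s M) (op_t M) (p_op M) (q_op xi M) (r_op xi M) v)
  /\ (forall v, op_t M (op_t M v) = z *: v).

Lemma pqr_of_Amodule l (M : Aops k) v : is_Amodule l lam mu M ->
  pqr_rel xi lam mu (op_s M) (op_t M) (p_op M) (q_op xi M) (r_op xi M) v.
Proof. by case/is_AmoduleP=> _ A; apply: (pqr_rel_of_a n3 xi2). Qed.

(** [l] is quantified inside because it only enters through z^l = 1. *)
Definition model_of z (D : monomial k) (M : Aops k) (e : nat -> M) :=
  [/\ graded_by z M, satisfies xi D e & forall l, z ^+ l = 1 -> is_Amodule l lam mu M].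

Lemma monomial_module_model z (D : monomial k) : well_formed D ->
  (forall (V : vectType k) (e : nat -> V) (s t p q r : 'End(V)),
     obeys e s t p q r D -> forall i, (i <= deg D)%N ->
     pqr_rel xi lam mu s t p q r (e i) /\ t (t (e i)) = z *: e i) ->
  model_of z D (M := monomial_module D) (unit_vec k (deg D)).
Proof.
move=> wD check; have /and5P[ws wt wp wq /andP[wr _]] := wD.
set n := deg D; set S := mx_op (tab_mx n.+1 (s_tab D)).
set T := mx_op (tab_mx n.+1 (t_tab D)); set P := mx_op (tab_mx n.+1 (p_tab D)).
set Q := mx_op (tab_mx n.+1 (q_tab D)); set R := mx_op (tab_mx n.+1 (r_tab D)).
have ob : obeys (unit_vec k n) S T P Q R D.
  by move=> i lein; split; apply: tab_mxE.
have rel i lein := (check _ _ _ _ _ _ _ ob i lein).1.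
have tt i lein := (check _ _ _ _ _ _ _ ob i lein).2.
have ttv (v : 'cV[k]_n.+1) : T (T v) = z *: v.
  rewrite [v]unit_vec_span; elim/big_rec: _ => [|i w _ IH].
    by rewrite !lf0 scaler0.
  by rewrite !(lfD, lfZ) IH (tt i (ltn_ord i)) scalerDr !scalerA mulrC.
split; [split=> [v|]; last exact: ttv | exact: (monomial_module_satisfies n3 xi2 wD rel) | ].
  have [pE qE rE] := monomial_module_pqr n3 xi2 rel; rewrite pE qE rE.
  rewrite [v]unit_vec_span; elim/big_rec: _ => [|i u _ IH].
    have := pqr_rel_lin (- 1) (rel _ (leq0n n)) (rel _ (leq0n n)).
    by rewrite scaleN1r addNr.
  by apply: pqr_rel_lin => //; apply: rel; rewrite -ltnS.
move=> l zl; exact: (monomial_module_is_Amodule n3 xi2 rel zl tt).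
Qed.

Lemma line_model z b : b ^+ 2 = z -> mu * z = mu -> lam * z = lam ->
  model_of z (line b) (M := monomial_module (line b)) (unit_vec k 0).
Proof.
move=> b2 mz lz; apply: monomial_module_model => // V e s t p q r ob i lei.
split; first exact: (line_rel n3 xi b2 mz lz ob).
have [_ t0 _ _ _] := ob 0%N isT; move: i lei => [|//] _.
by rewrite t0; expand; rewrite t0 scalerA -b2.
Qed.

Lemma plane_model z a c : phi lam mu z = 0 -> a ^+ 2 = lam / 3 ->
  c ^+ 2 = lam / 3 ->
  model_of z (plane z xi a c) (M := monomial_module (plane z xi a c)) (unit_vec k 1).
Proof.
move=> ph a2 c2; apply: monomial_module_model => // V e s t p q r ob i lei.
split; first exact: (plane_rel n3 xi2 ph a2 c2 ob).
have [_ t0 _ _ _] := ob 0%N isT; have [_ t1 _ _ _] := ob 1%N isT.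
rewrite /follows /entry /= in t0 t1.
by case: i lei => [|[|//]] _; rewrite ?(t0, t1); expand; rewrite ?(t0, t1) scalerA ?mul1r ?mulr1.
Qed.

Lemma tee_model z b : b ^+ 2 = z -> phi lam mu z = 0 ->
  model_of z (tee b (gg lam mu z)) (M := monomial_module (tee b (gg lam mu z))) (unit_vec k 1).
Proof.
move=> b2 ph; apply: monomial_module_model => // V e s t p q r ob i lei.
split; first exact: (tee_rel n3 xi2 b2 ph ob).
have [_ t0 _ _ _] := ob 0%N isT; have [_ t1 _ _ _] := ob 1%N isT.
rewrite /follows /entry /= in t0 t1.
by case: i lei => [|[|//]] _; rewrite ?(t0, t1); expand; rewrite ?(t0, t1);
  rewrite -b2; vect.
Qed.

Lemma six_model z b c1 c2 t1 t2 : b != 0 -> b ^+ 2 = z ->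
  c1 * c2 = gg lam mu z -> t1 * t2 = ff lam mu z ->
  c1 * t1 = hh lam mu z - c2 * t2 ->
  let D := six z xi b (- phi lam mu z / b) c1 c2 t1 t2 in
  model_of z D (M := monomial_module D) (unit_vec k 5).
Proof.
move=> b0 b2 cc tt ct D; apply: monomial_module_model => // V e s t p q r ob i lei.
split; first exact: (six_rel n3 xi2 b0 b2 cc tt ct ob).
have [_ e0 _ _ _] := ob 0%N isT; have [_ e1 _ _ _] := ob 1%N isT.
have [_ e2 _ _ _] := ob 2%N isT; have [_ e3 _ _ _] := ob 3%N isT.
have [_ e4 _ _ _] := ob 4%N isT; have [_ e5 _ _ _] := ob 5%N isT.
rewrite /follows /entry /= in e0 e1 e2 e3 e4 e5.
move: i lei => i; do 6?[case: i => [|i] //] => _;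
  rewrite ?(e0, e1, e2, e3, e4, e5); expand;
  rewrite ?(e0, e1, e2, e3, e4, e5) -?b2; vect.
Qed.

End Models.

(** * Simplicity of the four families *)

Section Simplicity.

Variables (k : closedFieldType) (n2 : 2 != 0 :> k) (n3 : 3 != 0 :> k).
Variables (xi : k) (xi2 : xi ^+ 2 = - 1 - xi) (lam mu z : k) (z0 : z != 0).

Lemma xi_sq_neq : [/\ xi ^+ 2 != 1, xi ^+ 2 != xi & xi != 1].
Proof.
have x0 := xi_neq0 xi2; have x1 := xi_neq1 n3 xi2; split=> //.
  apply: contra x1 => /eqP e; apply/eqP.
  by rewrite -[RHS](xi3 xi2) exprS e mulr1.
by rewrite -{2}[xi]mulr1 expr2 (inj_eq (mulfI x0)).
Qed.

Lemma diag_coord n (T : table k) (v : 'cV[k]_n.+1) (i : 'I_n.+1) :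
  (forall j, (j <= n)%N -> (entry T j).1 = j) ->
  mx_op (tab_mx n.+1 T) v i 0 = (entry T i).2 * v i 0.
Proof.
move=> diagT; rewrite lfunE /= mxE (bigD1 i) //= big1 ?addr0.
  by rewrite mxE diagT ?eqxx // -ltnS.
move=> j /negPf ji; rewrite mxE diagT ?leq_ord // val_eqE eq_sym ji.
by rewrite mul0r.
Qed.

Lemma unit_vec_neq0 n i : unit_vec k n i != 0.
Proof.
apply/eqP => /colP/(_ (inord i)); rewrite !mxE !eqxx => /eqP.
by rewrite oner_eq0.
Qed.

(** Simplicity of a monomial module: every nonzero vector generates each vector
of the basis. *)
Lemma simple_of_unit_vec (D : monomial k) :
  (forall U : {vspace monomial_module D}, stable xi U -> forall v, v \in U -> v != 0 ->
     forall i, (i <= deg D)%N -> unit_vec k (deg D) i \in U) ->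
  is_simple (monomial_module D).
Proof.
move=> unitU; split.
  move=> full0; have := memvf (unit_vec k (deg D) 0 : monomial_module D).
  by rewrite full0 memv0 (negPf (unit_vec_neq0 _ _)).
move=> U /(stableP n3 xi2) stU; have [->|U0] := eqVneq U 0%VS; first by left.
right; apply/eqP; rewrite eqEsubv subvf /=; apply/subvP=> v _.
rewrite [v]unit_vec_span; elim/big_rec: _ => [|i u _ IH]; first exact: mem0v.
rewrite memvD ?memvZ //; apply: (unitU U stU (vpick U)); rewrite ?memv_pick ?vpick0 //.
by rewrite -ltnS.
Qed.

Section Line.

Variable b : k.
Let M := monomial_module (line b).

Lemma line_facts (v : M) : model_of xi lam mu z (line b) (M := M) (unit_vec k 0) ->
  [/\ op_s M v = v, op_t M v = b *: v, p_op M v = 0, q_op xi M v = 0 &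
      r_op xi M v = 0].
Proof.
case=> _ /(_ 0%N isT)[s0 t0 p0 q0 r0] _; rewrite [v]unit_vec_span big_ord1.
rewrite /follows /entry /= in s0 t0 p0 q0 r0.
split; rewrite lfZ ?(s0, t0, p0, q0, r0) /= ?scale1r ?scale0r ?scaler0 //.
by rewrite !scalerA mulrC.
Qed.

Lemma line_simple : is_simple M.
Proof.
apply: simple_of_unit_vec => U stU v Uv v0 [|//] _.
have vE : v = v ord0 0 *: unit_vec k 0 0 by rewrite {1}[v]unit_vec_span big_ord1.
have c0 : v ord0 0 != 0 by apply: contra v0 => /eqP c0; rewrite vE c0 scale0r.
by rewrite -[unit_vec _ _ _]scale1r -(mulVf c0) -scalerA -vE memvZ.
Qed.

End Line.

Section Plane.

Variables a c : k.
Let D := plane z xi a c.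
Let M := monomial_module D.
Hypothesis mod : model_of xi lam mu z D (M := M) (unit_vec k 1).

Lemma plane_V0 (v : M) : op_s M v = v -> v = 0.
Proof.
have [x21 x2x x1] := xi_sq_neq.
move=> sv; apply/colP => i; rewrite mxE.
have := diag_coord (T := s_tab D) v i; rewrite [mx_op _ v]sv.
case: i => -[|[|//]] i /(_ ltac:(by do 2?[case=> //])) /= /eqP;
  by rewrite -subr_eq0 -{1}[v _ _]mul1r -mulrBl mulf_eq0 subr_eq0 eq_sym
    ?(negPf x1) ?(negPf x21) => /eqP.
Qed.

Lemma plane_V1 (v : M) : op_s M v = xi *: v -> exists x, v = x *: unit_vec k 1 0.
Proof.
have [x21 x2x x1] := xi_sq_neq.
move=> sv; exists (v ord0 0); rewrite {1}[v]unit_vec_span big_ord_recl big_ord1.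
rewrite (_ : v (lift ord0 ord0) 0 = 0) ?scale0r ?addr0 //.
have := diag_coord (T := s_tab D) v (lift ord0 ord0); rewrite [mx_op _ v]sv mxE.
move=> /(_ ltac:(by do 2?[case=> //])) /= /eqP.
by rewrite -subr_eq0 -mulrBl mulf_eq0 subr_eq0 eq_sym (negPf x2x) => /eqP.
Qed.

Lemma plane_facts (v : M) : op_s M v = xi *: v ->
  p_op M v = a *: v /\ q_op xi M v = c *: op_t M v.
Proof.
case/plane_V1=> x ->; have [_ /(_ 0%N isT)[_ t0 p0 q0 _] _] := mod.
rewrite /follows /entry /= in t0 p0 q0.
by rewrite !lfZ t0 p0 q0; split; vect.
Qed.

Lemma plane_simple : is_simple M.
Proof.
have [[rel tz] sat _] := mod.
apply: simple_of_unit_vec => U stU v Uv v0.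
have [[w [Uw w0 sw]]|[w [Uw w0 sw]]] := grade_cases n3 xi2 z0 rel tz stU Uv v0.
  by rewrite (plane_V0 sw) eqxx in w0.
have [x wE] := plane_V1 sw.
have x0 : x != 0 by apply: contra w0 => /eqP x0; rewrite wE x0 scale0r.
have U0 : unit_vec k 1 0 \in U.
  by rewrite -[unit_vec _ _ _]scale1r -(mulVf x0) -scalerA -wE memvZ.
case=> [//|[|//]] _.
have [_ t0 _ _ _] := sat 0%N isT; have [_ Ut _ _ _] := stU _ U0.
by rewrite t0 /= scale1r in Ut.
Qed.

End Plane.

Lemma scale_mem (V : vectType k) (U : {vspace V}) a v :
  a != 0 -> a *: v \in U -> v \in U.
Proof.
by move=> a0 Uav; rewrite -[v]scale1r -(mulVf a0) -scalerA memvZ.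
Qed.

Section Tee.

Variables b g : k.
Hypotheses (b0 : b != 0) (g0 : g != 0).
Let D := tee b g.
Let M := monomial_module D.
Hypothesis mod : model_of xi lam mu z D (M := M) (unit_vec k 1).

Lemma tee_expand (v : M) : exists x y, v = x *: unit_vec k 1 0 + y *: unit_vec k 1 1.
Proof.
exists (v ord0 0), (v (lift ord0 ord0) 0).
by rewrite {1}[v]unit_vec_span big_ord_recl big_ord1.
Qed.

Lemma tee_facts (v : M) : [/\ op_s M v = v, q_op xi M v = 0 & r_op xi M v = 0].
Proof.
have [_ sat _] := mod; have [s0 _ _ q0 r0] := sat 0%N isT.
have [s1 _ _ q1 r1] := sat 1%N isT; have [x [y ->]] := tee_expand v.
rewrite /follows /entry /= in s0 s1 q0 q1 r0 r1.
by rewrite !(lfD, lfZ) s0 s1 q0 q1 r0 r1; split; vect.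
Qed.

Lemma tee_simple : is_simple M.
Proof.
have [_ sat _] := mod; have [_ t0 p0 _ _] := sat 0%N isT.
have [_ t1 p1 _ _] := sat 1%N isT.
rewrite /follows /entry /= in t0 t1 p0 p1.
apply: simple_of_unit_vec => U stU v Uv v0.
have U01 : unit_vec k 1 0 \in U -> unit_vec k 1 1 \in U.
  by move=> U0; have [_ _ Up _ _] := stU _ U0; rewrite p0 scale1r in Up.
have U10 : unit_vec k 1 1 \in U -> unit_vec k 1 0 \in U.
  by move=> U1; have [_ _ Up _ _] := stU _ U1; rewrite p1 in Up; exact: scale_mem Up.
suff [U0 U1] : unit_vec k 1 0 \in U /\ unit_vec k 1 1 \in U.
  by case=> [//|[|//]].
have [x [y vE]] := tee_expand v; have [_ Ut _ _ _] := stU _ Uv.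
have [x0|nx0] := eqVneq x 0.
  have y0 : y != 0.
    by apply: contra v0 => /eqP y0; rewrite vE x0 y0 !scale0r addr0.
  have U1 : unit_vec k 1 1 \in U.
    by apply: (scale_mem y0); rewrite vE x0 scale0r add0r in Uv.
  by split; first exact: U10.
suff U0 : unit_vec k 1 0 \in U by split; last exact: U01.
apply: (@scale_mem _ _ (2 * b * x)); first by rewrite !mulf_neq0.
have -> : (2 * b * x) *: unit_vec k 1 0 = op_t M v + b *: v.
  by rewrite vE !(lfD, lfZ) t0 t1; vect.
by rewrite memvD ?memvZ.
Qed.

End Tee.

Section Six.

Variables b c1 c2 t1 t2 : k.
Local Notation phi := (phi lam mu z).
Hypotheses (b0 : b != 0) (phi0 : phi != 0).
Let D := six z xi b (- phi / b) c1 c2 t1 t2.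
Let M := monomial_module D.
Hypothesis mod : model_of xi lam mu z D (M := M) (unit_vec k 5).
Local Notation E := (unit_vec k 5).

Lemma six_V0 (v : M) : op_s M v = v -> exists x y, v = x *: E 0 + y *: E 1.
Proof.
have [x21 x2x x1] := xi_sq_neq.
move=> sv; have vi (i : 'I_6) : (entry (s_tab D) i).2 != 1 -> v i 0 = 0.
  move=> ci; have := diag_coord (T := s_tab D) v i; rewrite [mx_op _ v]sv.
  move=> /(_ ltac:(by do 6?[case=> //])) /= /eqP.
  rewrite -subr_eq0 -{1}[v _ _]mul1r -mulrBl mulf_eq0 subr_eq0 eq_sym.
  by rewrite (negPf ci) => /eqP.
exists (v ord0 0), (v (lift ord0 ord0) 0).
rewrite {1}[v]unit_vec_span !big_ord_recl big_ord0 /=.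
by rewrite !(vi (lift _ (lift _ _))) //= !scale0r !addr0.
Qed.

Let tab : satisfies xi D (M := M) E.
Proof. by case: mod. Qed.

Lemma six_chain : [/\ r_op xi M (p_op M (q_op xi M (E 0))) = - (phi * t2) *: E 1,
  r_op xi M (p_op M (q_op xi M (E 1))) = - (phi * t1) *: E 0,
  p_op M (E 0) = c1 *: E 1 & p_op M (E 1) = c2 *: E 0].
Proof.
have [_ _ p0 q0 _] := @tab 0%N isT; have [_ _ p1 q1 _] := @tab 1%N isT.
have [_ _ p2 _ r2] := @tab 2%N isT; have [_ _ p3 _ r3] := @tab 3%N isT.
rewrite /follows /entry /= in p0 p1 p2 p3 q0 q1 r2 r3.
split=> //; rewrite ?(q0, q1) lfZ ?(p2, p3) !lfZ ?(r2, r3);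
  by coords; field.
Qed.

Lemma six_facts (v : M) : op_s M v = v -> op_t M v = b *: v ->
  r_op xi M (p_op M (q_op xi M (p_op M v))) = - (phi * (c1 * t1)) *: v.
Proof.
case/six_V0=> x [y vE] tv.
have [_ te0 _ _ _] := @tab 0%N isT; have [_ te1 _ _ _] := @tab 1%N isT.
rewrite /follows /entry /= in te0 te1.
have y0 : y *: E 1 = 0.
  apply: (scalerI (a := 2 * b)); first by rewrite mulf_neq0.
  have -> : (2 * b) *: (y *: E 1) = b *: v - op_t M v.
    by rewrite vE !(lfD, lfZ) te0 te1; vect.
  by rewrite tv subrr scaler0.
have [_ e1 e2 _] := six_chain.
by rewrite vE y0 addr0 !lfZ e2 !lfZ e1; vect.
Qed.

(** A submodule meets V_0, as r is injective on V_1, and then contains x or y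
because t has distinct eigenvalues there.  The two alternatives on the
parameters say that x and y generate each other under p and rpq. *)
Lemma six_simple : c1 != 0 \/ t2 != 0 -> c2 != 0 \/ t1 != 0 -> is_simple M.
Proof.
move=> c1t2 c2t1; have [[rel tz] sat _] := mod.
apply: simple_of_unit_vec => U stU v Uv v0.
have Ut u : u \in U -> op_t M u \in U by case/stU=> _ Uu _ _ _; exact: Uu.
have Up u : u \in U -> p_op M u \in U by case/stU=> _ _ Uu _ _; exact: Uu.
have Uq u : u \in U -> q_op xi M u \in U by case/stU=> _ _ _ Uu _; exact: Uu.
have Ur u : u \in U -> r_op xi M u \in U by case/stU=> _ _ _ _ Uu; exact: Uu.
have [e0 e1 e2 e3] := six_chain.
have U01 : E 0 \in U -> E 1 \in U.
  move=> U0; case: c1t2 => n0; first by apply: (scale_mem n0); rewrite -e2 Up.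
  apply: (@scale_mem _ _ (- (phi * t2))); first by rewrite oppr_eq0 mulf_neq0.
  by rewrite -e0 Ur ?Up ?Uq.
have U10 : E 1 \in U -> E 0 \in U.
  move=> U1; case: c2t1 => n0; first by apply: (scale_mem n0); rewrite -e3 Up.
  apply: (@scale_mem _ _ (- (phi * t1))); first by rewrite oppr_eq0 mulf_neq0.
  by rewrite -e1 Ur ?Up ?Uq.
suff [U0 U1] : E 0 \in U /\ E 1 \in U.
  have [_ _ _ q0 r0] := @tab 0%N isT; have [_ _ _ q1 r1] := @tab 1%N isT.
  rewrite /follows /entry /= in q0 q1 r0 r1.
  have U2 : E 2 \in U by apply: (@scale_mem _ _ (- b)); rewrite ?oppr_eq0 // -q0 Uq.
  have U3 : E 3 \in U by apply: (scale_mem b0); rewrite -q1 Uq.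
  have U4 : E 4 \in U by rewrite -[E 4]scale1r -r0 Ur.
  have U5 : E 5 \in U by rewrite -[E 5]scale1r -r1 Ur.
  by do 6?[case=> //].
have [w [Uw w0 sw]] : exists w, [/\ w \in U, w != 0 & op_s M w = w].
  have [//|[w [Uw w0 sw]]] := grade_cases n3 xi2 z0 rel tz stU Uv v0.
  exists (r_op xi M w); split; [exact: Ur| |exact: (s1r xi2 rel sw)].
  apply: contra w0 => /eqP rw; have := qr1 n3 xi2 rel tz sw.
  by rewrite rw lf0 => /esym/eqP; rewrite scaler_eq0 (negPf phi0).
have [x [y wE]] := six_V0 sw.
have [_ te0 _ _ _] := @tab 0%N isT; have [_ te1 _ _ _] := @tab 1%N isT.
rewrite /follows /entry /= in te0 te1.
have [x0|nx0] := eqVneq x 0.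
  have y0 : y != 0.
    by apply: contra w0 => /eqP y0; rewrite wE x0 y0 !scale0r addr0.
  have U1 : E 1 \in U.
    by apply: (scale_mem y0); rewrite wE x0 scale0r add0r in Uw.
  by split; first exact: U10.
suff U0 : E 0 \in U by split; last exact: U01.
apply: (@scale_mem _ _ (2 * b * x)); first by rewrite !mulf_neq0.
have -> : (2 * b * x) *: E 0 = op_t M w + b *: w.
  by rewrite wE !(lfD, lfZ) te0 te1; vect.
by rewrite memvD ?memvZ ?Ut.
Qed.

End Six.

End Simplicity.

(** * Recognizing a family from one vector *)

Section Generators.

Variables (k : closedFieldType) (n3 : 3 != 0 :> k).
Variables (xi : k) (xi2 : xi ^+ 2 = - 1 - xi) (lam mu z : k).
Variable M : Aops k.
Let s := op_s M.
Let t := op_t M.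
Let p := p_op M.
Let q := q_op xi M.
Let r := r_op xi M.
Hypothesis rel : forall v, pqr_rel xi lam mu s t p q r v.
Hypothesis tz : forall v, t (t v) = z *: v.

Local Notation phi := (phi lam mu z).
Local Notation gg := (gg lam mu z).
Local Notation ff := (ff lam mu z).
Local Notation hh := (hh lam mu z).

Lemma line_satisfies b (v : M) : s v = v -> t v = b *: v -> p v = 0 -> q v = 0 ->
  r v = 0 -> satisfies xi (line b) (fun _ => v).
Proof.
move=> sv tv pv qv rv [|//] _; rewrite /follows /entry /= -/s -/t -/p -/q -/r.
by rewrite sv tv pv qv rv scale1r scale0r.
Qed.

Lemma plane_satisfies a c (v : M) : s v = xi *: v -> p v = a *: v ->
  q v = c *: t v -> r v = 0 ->
  satisfies xi (plane z xi a c) (fun i => nth 0 [:: v; t v] i).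
Proof.
move=> sv pv qv rv.
have st := s1t rel sv.
have pt : p (t v) = - a *: t v by rewrite -[p (t v)]opprK -(gr_tp rel) pv; vect.
have qt : q (t v) = 0 by rewrite -[q (t v)]opprK -(gr_tr rel) rv lf0 oppr0.
have rt : r (t v) = - (z * c) *: v.
  by rewrite -[r (t v)]opprK -(gr_tq rel) qv; expand; rewrite tz; vect.
move=> [|[|//]] _; rewrite /follows /entry /= -/s -/t -/p -/q -/r.
  by rewrite sv pv qv rv scale1r scale0r.
by rewrite st tz pt qt rt scale0r.
Qed.

Lemma tee_satisfies b (v : M) : s v = v -> t v = b *: v -> q v = 0 -> r v = 0 ->
  q (p v) = 0 -> r (p v) = 0 ->
  satisfies xi (tee b gg) (fun i => nth 0 [:: v; p v] i).
Proof.
move=> sv tv qv rv qp rp; have sp := s0p rel sv.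
have tp : t (p v) = - b *: p v by rewrite (gr_tp rel) tv; vect.
have pp := pp0 n3 xi2 rel tz sv.
move=> [|[|//]] _; rewrite /follows /entry /= -/s -/t -/p -/q -/r.
  by rewrite sv tv qv rv !scale1r !scale0r.
by rewrite sp tp pp qp rp scale1r !scale0r.
Qed.

Section Six.

Variables b c1 c2 t1 t2 : k.
Hypotheses (b0 : b != 0) (b2 : b ^+ 2 = z) (phi0 : phi != 0).

(** The remaining four basis vectors are forced by the matrix of a_0, in which
q x = - b v_1, q y = b v_2, r x = w_1 and r y = w_2.  As q r = phi on V_1,
the values of p on them follow from those of rpq on x and y. *)
Lemma six_satisfies (x y : M) : s x = x -> s y = y -> t x = b *: x ->
  t y = - b *: y -> p x = c1 *: y -> p y = c2 *: x ->
  r (p (q x)) = - (phi * t2) *: y -> r (p (q y)) = - (phi * t1) *: x ->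
  satisfies xi (six z xi b (- phi / b) c1 c2 t1 t2)
    (fun i => nth 0 [:: x; y; - b^-1 *: q x; b^-1 *: q y; r x; r y] i).
Proof.
move=> sx sy tx ty px py Px Py.
(* Apply phi = qr on V_1 to the vector p q u. *)
have pqE u w c : s u = u -> r (p (q u)) = - (phi * c) *: w -> p (q u) = - c *: q w.
  move=> su e; apply: (scalerI phi0).
  rewrite -(qr1 n3 xi2 rel tz (s1p rel (s0q rel su))) -/q -/r e; vect.
have pqx := pqE _ _ _ sx Px; have pqy := pqE _ _ _ sy Py.
have prx : p (r x) = - t2 *: r y.
  apply: (scalerI b0); have : t (p (q x)) = t (- t2 *: q y) by rewrite pqx.
  rewrite (gr_tp rel) !(lfZ, gr_tq rel) -/t tx ty => e.
  have -> : b *: p (r x) = - p (- r (b *: x)) by vect.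
  by rewrite e; vect.
have pry : p (r y) = - t1 *: r x.
  apply: (scalerI b0); have : t (p (q y)) = t (- t1 *: q x) by rewrite pqy.
  rewrite (gr_tp rel) !(lfZ, gr_tq rel) -/t tx ty => e.
  have -> : b *: p (r y) = - (- p (- r (- b *: y))) by vect.
  by rewrite e; vect.
have qqx : q (q x) = (t2 - c1) *: r y.
  have -> : q (q x) = - p (r x) - r (p x) by rewrite (gr_pr rel); vect.
  by rewrite prx px; vect.
have qqy : q (q y) = (t1 - c2) *: r x.
  have -> : q (q y) = - p (r y) - r (p y) by rewrite (gr_pr rel); vect.
  by rewrite pry py; vect.
have rrx : r (r x) = (t2 - c1) *: q y.
  have -> : r (r x) = - p (q x) - q (p x) by rewrite (gr_pq rel); vect.
  by rewrite pqx px; vect.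
have rry : r (r y) = (t1 - c2) *: q x.
  have -> : r (r y) = - p (q y) - q (p y) by rewrite (gr_pq rel); vect.
  by rewrite pqy py; vect.
move=> i; do 6?[case: i => [|i] //] => _;
  rewrite /follows /entry /= -/s -/t -/p -/q -/r ?lfZ.
- by rewrite sx tx px; split=> //; coords; field.
- by rewrite sy ty py; split=> //; coords; field.
- rewrite (s0q rel sx) (gr_tq rel) -/t tx pqx qqx (rq0 n3 xi2 rel tz sx).
  by split; coords; field.
- rewrite (s0q rel sy) (gr_tq rel) -/t ty pqy qqy (rq0 n3 xi2 rel tz sy).
  by split; coords; field.
- rewrite (s0r rel sx) (gr_tr rel) -/t tx prx (qr0 n3 xi2 rel tz sx) rrx -b2.
  by split=> //; coords; field.
- rewrite (s0r rel sy) (gr_tr rel) -/t ty pry (qr0 n3 xi2 rel tz sy) rry -b2.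
  by split=> //; coords; field.
Qed.

(** The partner y is a multiple of p x or of rpq x.  The last of the required
equations follows because p and rpq have scalar squares gg and phi^2 ff, not
both zero, so a vector of V_0 is determined by its images under them. *)
Lemma six_partner (x : M) : c1 * c2 = gg -> t1 * t2 = ff ->
  c1 * t1 = hh - c2 * t2 -> c1 != 0 \/ t2 != 0 ->
  s x = x -> t x = b *: x -> r (p (q (p x))) = - (phi * (c1 * t1)) *: x ->
  exists y, [/\ s y = y, t y = - b *: y, p x = c1 *: y &
    [/\ p y = c2 *: x, r (p (q x)) = - (phi * t2) *: y
       & r (p (q y)) = - (phi * t1) *: x]].
Proof.
move=> cc tt ct c1t2 sx tx Kx.
have z0 : z != 0 by rewrite -b2 expf_neq0.
have inj u w : s u = u -> s w = w -> p u = p w -> r (p (q u)) = r (p (q w)) ->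
    u = w.
  move=> su sw e1 e2; case: (gg_ff_neq0 n3 z0 phi0) => n0.
    by apply: (scalerI n0); rewrite -!(pp0 n3 xi2 rel tz) // -/p e1.
  apply: (@scalerI _ _ (phi ^+ 2 * ff)); first by rewrite mulf_neq0 ?expf_neq0.
  by rewrite -!(rpq_rpq n3 xi2 rel tz) // -/r -/p -/q e2.
have sP u : s u = u -> s (r (p (q u))) = r (p (q u)).
  by move=> su; apply/(s1r xi2 rel)/(s1p rel)/(s0q rel).
(* From the anticommutator of p and rpq, since h = c_1 t_1 + c_2 t_2. *)
have pPx : p (r (p (q x))) = - (phi * (c2 * t2)) *: x.
  have := clifford n3 xi2 rel tz sx; rewrite -/r -/p -/q Kx => e.
  have -> : p (r (p (q x))) = - (phi * (c1 * t1)) *: x + p (r (p (q x)))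
      + phi * (c1 * t1) *: x by vect.
  by rewrite e ct; vect.
case: c1t2 => n0.
  set y := c1^-1 *: p x.
  have px : p x = c1 *: y by rewrite scalerA mulfV // scale1r.
  have sy : s y = y by rewrite lfZ (s0p rel sx).
  have ty : t y = - b *: y by rewrite lfZ (gr_tp rel) -/t tx /y; vect.
  have py : p y = c2 *: x.
    by rewrite lfZ (pp0 n3 xi2 rel tz sx) -cc scalerA; congr (_ *: _); field.
  have Py : r (p (q y)) = - (phi * t1) *: x.
    by rewrite !lfZ Kx scalerA; congr (_ *: _); field.
  clearbody y; exists y; split=> //; split=> //.
  apply: inj; [exact: sP | by rewrite lfZ sy | |].
    by rewrite pPx lfZ py; vect.
  by rewrite (rpq_rpq n3 xi2 rel tz sx) !lfZ Py -tt; vect.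
have n1 : - (phi * t2) != 0 by rewrite oppr_eq0 mulf_neq0.
set y := (- (phi * t2))^-1 *: r (p (q x)).
have Px : r (p (q x)) = - (phi * t2) *: y by rewrite scalerA mulfV // scale1r.
have sy : s y = y by rewrite lfZ sP.
have py : p y = c2 *: x.
  by rewrite lfZ pPx scalerA; congr (_ *: _); field; rewrite ?n0 ?phi0.
have Py : r (p (q y)) = - (phi * t1) *: x.
  rewrite !lfZ (rpq_rpq n3 xi2 rel tz sx) -/ff -tt scalerA; congr (_ *: _).
  by field; rewrite ?n0 ?phi0.
have ty : t y = - b *: y by rewrite lfZ (t_rpq n3 xi2 rel tz sx) -/t tx /y; vect.
clearbody y; exists y; split=> //.
apply: inj; [exact: (s0p rel sx) | by rewrite lfZ sy | |].
  by rewrite lfZ py (pp0 n3 xi2 rel tz sx) -cc scalerA.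
by rewrite !lfZ Py Kx; vect.
Qed.

End Six.

End Generators.

(** * Labels and the classification principle *)

Section Lists.

Variables (I : eqType) (T : Type) (F : I -> T).

Lemma Forall_map (P : T -> Prop) (s : seq I) :
  (forall i, i \in s -> P (F i)) -> List.Forall P (map F s).
Proof.
elim: s => [|i s IHs] Ps; constructor; first by apply: Ps; rewrite mem_head.
by apply: IHs => j js; apply: Ps; rewrite inE js orbT.
Qed.

Lemma Exists_map (P : T -> Prop) (s : seq I) i :
  i \in s -> P (F i) -> List.Exists P (map F s).
Proof.
elim: s => [//|j s IHs]; rewrite inE => /orP[/eqP <- Pi|/IHs H /H]; last by right.
by left.
Qed.

Lemma ForallOrdPairs_map (R : T -> T -> Prop) (s : seq I) : uniq s ->
  (forall i j, i \in s -> j \in s -> i <> j -> R (F i) (F j)) ->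
  List.ForallOrdPairs R (map F s).
Proof.
elim: s => [|i s IHs] /=; first by constructor.
move=> /andP[nis us] Rs; constructor.
  apply: Forall_map => j js; apply: Rs; rewrite ?mem_head ?inE ?js ?orbT //.
  by move=> ij; rewrite ij js in nis.
by apply: IHs => // j j' js js'; apply: Rs; rewrite inE ?js ?js' orbT.
Qed.

End Lists.

(** [Line be] stands for S_j^(+-) with t = be, [Plane j a c] for L_j(a,c),
[Tee j] for T_j, and [Six j e] for N_j^(1) or N_j^(2) according to [e]. *)
Inductive label (k : Type) :=
  | Line of k | Plane of nat & k & k | Tee of nat | Six of nat & bool.
Arguments Tee {k} j.
Arguments Six {k} j e.

Section LabelEq.

Variable k : eqType.

Definition label_code (i : label k) : (k + nat * k * k) + (nat + nat * bool) :=
  match i with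
  | Line b => inl (inl b) | Plane j a c => inl (inr (j, a, c))
  | Tee j => inr (inl j) | Six j e => inr (inr (j, e))
  end.

Definition label_decode (x : (k + nat * k * k) + (nat + nat * bool)) : label k :=
  match x with
  | inl (inl b) => Line b | inl (inr (j, a, c)) => Plane j a c
  | inr (inl j) => Tee j | inr (inr (j, e)) => Six j e
  end.

Lemma label_codeK : cancel label_code label_decode.
Proof. by case. Qed.

End LabelEq.

HB.instance Definition _ (k : eqType) :=
  Equality.copy (label k) (can_type (@label_codeK k)).

Section Classification.

Variables (k : closedFieldType) (char0 : [pchar k] =i pred0).
Variables (l : nat) (l_gt0 : (0 < l)%N) (xi zeta : k).
Hypothesis xi2 : xi ^+ 2 = - 1 - xi.
Hypothesis zeta_prim : l.-primitive_root zeta.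
Variables (b : nat -> k) (lam mu : k) (d : nat -> k).
Hypothesis b_sq : forall j, (j < l)%N -> b j ^+ 2 = zeta ^+ j.

Let n2 : 2 != 0 :> k := natr_neq0 char0 1.
Let n3 : 3 != 0 :> k := natr_neq0 char0 2.
Let n9 : 9 != 0 :> k := natr_neq0 char0 8.

Let phi_z j := phi lam mu (zeta ^+ j).
Let gg_z j := gg lam mu (zeta ^+ j).
Let ff_z j := ff lam mu (zeta ^+ j).
Let hh_z j := hh lam mu (zeta ^+ j).

(** The scalar s_j, where d_j is a square root of the discriminant. *)
Definition sroot j := (hh_z j + d j) / 2.

(** For j in J and mu different from lam/3, this means that s_j = 0. *)
Definition exceptional j := (mu == - 2 * (lam / 3)) && (zeta ^+ j == - 1).

Definition six_par j (e : bool) : k * k * k * k :=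
  if e then (gg_z j, 1, ff_z j / sroot j, sroot j)
  else if exceptional j then (0, 0, 1, - (lam / 3))
  else (1, gg_z j, sroot j, ff_z j / sroot j).

Definition scalar_of (i : label k) : k :=
  match i with
  | Line be => be ^+ 2
  | Plane j _ _ | Tee j | Six j _ => zeta ^+ j
  end.

Definition data_of (i : label k) : monomial k :=
  match i with
  | Line be => line be
  | Plane j a c => plane (zeta ^+ j) xi a c
  | Tee j => tee (b j) (gg_z j)
  | Six j e => let: (c1, c2, t1, t2) := six_par j e in
               six (zeta ^+ j) xi (b j) (- phi_z j / b j) c1 c2 t1 t2
  end.

Definition module_of i := monomial_module (data_of i).

(** The product c_1 t_1, equal to minus the eigenvalue of Pp at the basis
vector x; it distinguishes N_j^(1) from N_j^(2). *)
Definition kappa j (e : bool) := if e then hh_z j - sroot j else sroot j.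

(** Conditions under which the label denotes a simple module over the algebra,
and distinct labels denote non-isomorphic modules. *)
Definition admissible (i : label k) : Prop :=
  match i with
  | Line be => [/\ (be ^+ 2) ^+ l = 1, mu * be ^+ 2 = mu & lam * be ^+ 2 = lam]
  | Plane j a c => [/\ (j < l)%N, phi_z j = 0, a ^+ 2 = lam / 3 & c ^+ 2 = lam / 3]
  | Tee j => [/\ (j < l)%N, phi_z j = 0 & gg_z j != 0]
  | Six j e => [/\ (j < l)%N, phi_z j != 0, d j ^+ 2 = hh_z j ^+ 2 - 4 * ff_z j * gg_z j
                 & if e then sroot j != 0 /\ d j != 0
                   else exceptional j \/ sroot j != 0]
  end.

(** Equations on a vector [v] of an arbitrary module that are satisfied by the
first basis vector of the module with label [i], and that force this module to
map onto the submodule generated by [v]. *)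
Definition generates (i : label k) (M : Aops k) (v : M) : Prop :=
  let s := op_s M in let t := op_t M in
  let p := p_op M in let q := q_op xi M in let r := r_op xi M in
  [/\ v != 0, t (t v) = scalar_of i *: v &
  match i with
  | Line be => [/\ s v = v, t v = be *: v, p v = 0, q v = 0 & r v = 0]
  | Plane j a c => [/\ s v = xi *: v, p v = a *: v, q v = c *: t v & r v = 0]
  | Tee j => [/\ s v = v, t v = b j *: v, q v = 0, r v = 0 &
                 [/\ p (p v) = gg_z j *: v, q (p v) = 0 & r (p v) = 0]]
  | Six j e => [/\ s v = v, t v = b j *: v, r (q v) = phi_z j *: v &
                   r (p (q (p v))) = - (phi_z j * kappa j e) *: v]
  end].

Lemma zeta_neq0 j : zeta ^+ j != 0.
Proof.
rewrite expf_neq0 //; have := oner_neq0 k.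
by apply: contra => /eqP z0; rewrite -(prim_expr_order zeta_prim) z0 expr0n eqn0Ngt l_gt0.
Qed.

Lemma zeta_expl j : (zeta ^+ j) ^+ l = 1.
Proof. by rewrite -exprM mulnC exprM (prim_expr_order zeta_prim) expr1n. Qed.

Lemma b_neq0 j : (j < l)%N -> b j != 0.
Proof.
move=> jl; have := zeta_neq0 j; rewrite -b_sq //.
by apply: contra => /eqP ->; rewrite expr0n.
Qed.

Lemma zeta_inj i j : (i < l)%N -> (j < l)%N -> zeta ^+ i = zeta ^+ j -> i = j.
Proof.
move=> il jl /eqP; rewrite (eq_prim_root_expr zeta_prim) !modn_small //.
by move/eqP.
Qed.

Lemma sroot_prod j : d j ^+ 2 = hh_z j ^+ 2 - 4 * ff_z j * gg_z j ->
  sroot j * (hh_z j - sroot j) = ff_z j * gg_z j.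
Proof.
move=> dj; have -> : sroot j * (hh_z j - sroot j) = (hh_z j ^+ 2 - d j ^+ 2) / 4.
  by rewrite /sroot; field; rewrite n2 (natr_neq0 char0 3).
by rewrite dj; field; rewrite (natr_neq0 char0 3).
Qed.

(** At these parameters the discriminant vanishes. *)
Lemma exceptional_values j : d j ^+ 2 = hh_z j ^+ 2 - 4 * ff_z j * gg_z j ->
  exceptional j ->
  [/\ hh_z j = 0, gg_z j = 0, ff_z j = - (lam / 3) & sroot j = 0].
Proof.
move=> dj /andP[/eqP muE /eqP zE].
have h0 : hh_z j = 0 by rewrite /hh_z /hh zE muE; field; rewrite ?n9 ?n3.
have g0 : gg_z j = 0 by rewrite /gg_z /gg zE muE; field; rewrite ?n9 ?n3.
split=> //; first by rewrite /ff_z /ff zE muE; field; rewrite ?n9 ?n3.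
have /eqP : sroot j ^+ 2 = 0.
  have -> : sroot j ^+ 2 = - (sroot j * (hh_z j - sroot j)) by rewrite h0; ring.
  by rewrite sroot_prod // g0 mulr0 oppr0.
by rewrite expf_eq0 => /eqP.
Qed.

Lemma six_par_spec j e : admissible (Six j e) ->
  exists c1 c2 t1 t2, [/\ six_par j e = (c1, c2, t1, t2),
    c1 * c2 = gg_z j, t1 * t2 = ff_z j, c1 * t1 = hh_z j - c2 * t2 &
    [/\ c1 * t1 = kappa j e, c1 != 0 \/ t2 != 0 & c2 != 0 \/ t1 != 0]].
Proof.
case=> jl ph dj ex; rewrite /six_par /kappa.
have sd := sroot_prod dj.
case: e ex => [[s0 d0]|].
  exists (gg_z j), 1, (ff_z j / sroot j), (sroot j).
  have e1 : gg_z j * (ff_z j / sroot j) = hh_z j - sroot j.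
    by apply: (mulfI s0); rewrite sd; field.
  split; rewrite ?mulr1 ?mul1r ?divfK //.
  by split=> //; [right | left; rewrite oner_neq0].
case: ifP => [exc _|_ [//|s0]].
  have [h0 g0 fE s0] := exceptional_values dj exc.
  exists 0, 0, 1, (- (lam / 3)).
  rewrite mulr0 !mul0r mul1r g0 fE h0 s0 subr0; split=> //; split=> //.
    right; rewrite oppr_eq0; apply: contra ph => /eqP l0.
    have /andP[/eqP muE _] := exc.
    by rewrite /phi_z /phi muE l0 mulr0 subrr !mul0r.
  by right; rewrite oner_neq0.
exists 1, (gg_z j), (sroot j), (ff_z j / sroot j).
have e1 : gg_z j * (ff_z j / sroot j) = hh_z j - sroot j.
  by apply: (mulfI s0); rewrite sd; field.
split; rewrite ?mulr1 ?mul1r ?[sroot j * _]mulrC ?divfK ?e1 //.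
  by rewrite opprB addrCA subrr addr0.
by split=> //; [left; rewrite oner_neq0 | right].
Qed.

Lemma scalar_neq0 i : admissible i -> scalar_of i != 0.
Proof.
case: i => [be [bel _ _]|j a c _|j _|j e _]; rewrite /= ?zeta_neq0 //.
by apply/eqP => b0; move: bel; rewrite b0 expr0n eqn0Ngt l_gt0 => /esym/eqP;
  rewrite oner_eq0.
Qed.

Lemma scalar_expl i : admissible i -> scalar_of i ^+ l = 1.
Proof. by case: i => [be [bel _ _]|j a c _|j _|j e _]; rewrite /= ?zeta_expl. Qed.

Lemma module_of_model i : admissible i ->
  model_of xi lam mu (scalar_of i) (data_of i) (M := module_of i)
    (unit_vec k (deg (data_of i))).
Proof.
case: i => [be [bel mb lb]|j a c [jl ph a2 c2]|j [jl ph g0]|j e ok].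
- exact: line_model.
- exact: plane_model.
- by apply: tee_model => //; exact: b_sq.
have [jl ph _ _] := ok; have [c1 [c2 [t1 [t2 [e1 cc tt ct _]]]]] := six_par_spec ok.
rewrite /module_of /= e1; apply: six_model => //; [exact: b_neq0 | exact: b_sq].
Qed.

Lemma module_of_simple i : admissible i -> is_simple (module_of i).
Proof.
move=> ok; have := module_of_model ok; have := scalar_neq0 ok.
case: i ok => [be [bel mb lb]|j a c [jl ph a2 c2]|j [jl ph g0]|j e ok].
- by move=> _ _; exact: (line_simple n3 xi2).
- by move=> z0 mod; exact: (plane_simple n3 xi2 z0 mod).
- by move=> z0 mod; exact: (tee_simple n2 n3 xi2 (b_neq0 jl) g0 mod).
have [jl ph _ _] := ok; have [c1 [c2 [t1 [t2 [e1 _ _ _ [_ n1 n4]]]]]] := six_par_spec ok.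
rewrite /module_of /= e1 => z0 mod.
exact: (six_simple n2 n3 xi2 z0 (b_neq0 jl) ph mod).
Qed.

Lemma satisfies_of_generates i (M : Aops k) (v : M) : admissible i ->
  graded_by xi lam mu (scalar_of i) M -> generates i v ->
  exists2 e : nat -> M, satisfies xi (data_of i) e & e 0%N = v.
Proof.
move=> ok [rel tz] [v0 _].
case: i ok rel tz => [be|j a c|j|j e] ok rel tz.
- case=> sv tv pv qv rv; exists (fun=> v) => //; exact: line_satisfies.
- case=> sv pv qv rv; eexists; first exact: (plane_satisfies rel tz sv pv qv rv).
  by [].
- case=> sv tv qv rv [pp qp rp]; eexists.
    exact: (tee_satisfies n3 xi2 rel tz sv tv qv rv qp rp).
  by [].
have [jl ph _ _] := ok.
have [c1 [c2 [t1 [t2 [e1 cc tt ct [ck n1 _]]]]]] := six_par_spec ok.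
rewrite /= e1 => -[sv tv _]; rewrite -ck => Kv.
have [y [sy ty px [py Px Py]]] :=
  six_partner n3 xi2 rel tz (b_neq0 jl) (b_sq jl) ph cc tt ct n1 sv tv Kv.
eexists; first exact:
  (six_satisfies n3 xi2 rel tz (b_neq0 jl) (b_sq jl) ph sv sy tv ty px py Px Py).
by [].
Qed.

Lemma generates_neq0 i (M : Aops k) (v : M) : generates i v -> v != 0.
Proof. by case. Qed.

Lemma generates_intertwine i (M N : Aops k) (f : 'Hom(M, N)) v :
  intertwines f -> f v != 0 -> generates i v -> generates i (f v).
Proof.
move=> fMN fv; have [fs ft _] := fMN; have [fp fq fr] := intertwines_pqr xi fMN.
case=> v0 tv iv; split=> //; first by rewrite -!ft tv lfZ.
case: i tv iv => [be|j a c|j|j e] _ /=; rewrite -?(fs, ft, fp, fq, fr).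
- by case=> -> -> -> -> ->; rewrite lfZ !lf0.
- by case=> -> -> -> ->; rewrite !lfZ lf0.
- by case=> -> -> -> -> [-> -> ->]; rewrite !lfZ !lf0.
- by case=> -> -> -> ->; rewrite !lfZ.
Qed.

Lemma line_module (be : k) (v : module_of (Line be)) : admissible (Line be) ->
  [/\ op_s _ v = v, op_t _ v = be *: v, p_op _ v = 0, q_op xi _ v = 0 &
      r_op xi _ v = 0].
Proof. move=> ok; exact: (line_facts v (module_of_model ok)). Qed.

Lemma plane_module j a c (v : module_of (Plane j a c)) :
  admissible (Plane j a c) ->
  (op_s _ v = v -> v = 0) /\
  (op_s _ v = xi *: v -> p_op _ v = a *: v /\ q_op xi _ v = c *: op_t _ v).
Proof.
move=> ok; split; first exact: (plane_V0 n3 xi2).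
exact: (plane_facts n3 xi2 (module_of_model ok)).
Qed.

Lemma tee_module j (v : module_of (Tee j)) : admissible (Tee j) ->
  [/\ op_s _ v = v, q_op xi _ v = 0 & r_op xi _ v = 0].
Proof. by move=> ok; exact: (tee_facts (module_of_model ok)). Qed.

Lemma six_module j e : admissible (Six j e) -> forall v : module_of (Six j e),
  op_s _ v = v -> op_t _ v = b j *: v ->
  r_op xi _ (p_op _ (q_op xi _ (p_op _ v))) = - (phi_z j * kappa j e) *: v.
Proof.
move=> ok; have [jl ph _ _] := ok; have := module_of_model ok.
have [c1 [c2 [t1 [t2 [e1 _ _ _ [<- _ _]]]]]] := six_par_spec ok.
rewrite /module_of /= e1 => mod.
exact: (six_facts n2 n3 xi2 (b_neq0 jl) mod).
Qed.

Lemma scaler_injl (V : vectType k) (v : V) x y :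
  v != 0 -> x *: v = y *: v -> x = y.
Proof.
move=> v0 /eqP; rewrite -subr_eq0 -scalerBl scaler_eq0 (negPf v0) orbF subr_eq0.
by move/eqP.
Qed.

(** The equation for t^2 determines j.  The family is read off the s-eigenvalue
and the scalars rq and p^2 on the vector, and within a family the parameters
are eigenvalues of p, of q relative to t, or of Pp. *)
Lemma generates_inj i i' (v : module_of i') :
  admissible i -> admissible i' -> generates i v -> i = i'.
Proof.
move=> ok ok'; have [[rel tz] _ _] := module_of_model ok'.
case=> v0; rewrite tz => /(scaler_injl v0) zE gen.
have null x : x *: v = 0 -> x = 0.
  by move=> /eqP; rewrite scaler_eq0 (negPf v0) orbF => /eqP.
have xv : v = xi *: v -> False.
  rewrite -{1}[v]scale1r => /(scaler_injl v0)/esym/eqP.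
  exact/negP/(xi_neq1 n3 xi2).
have tv0 : op_t _ v != 0.
  apply: contra v0 => /eqP tv; have := tz v; rewrite tv lf0 => /esym/eqP.
  by rewrite scaler_eq0 (negPf (scalar_neq0 ok')).
move: v v0 zE gen null xv tv0 rel tz ok ok'.
case: i' => [be'|j' a' c'|j'|j' e'] v v0 zE gen null xv tv0 rel tz ok ok'.
- have [s1 t1 p1 q1 r1] := line_module v ok'; move: gen.
  case: i zE ok => [be|j a c|j|j e] zE ok.
  + by case=> _; rewrite t1 => /(scaler_injl v0) ->.
  + by case; rewrite s1 => /xv.
  + have [_ _ /eqP g0] := ok.
    by case=> _ _ _ _ [pp _ _]; case: g0; apply: null; rewrite -pp p1 lf0.
  + have [_ /eqP ph _ _] := ok.
    by case=> _ _ rq _; case: ph; apply: null; rewrite -rq q1 lf0.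
- have [V0 V1] := plane_module v ok'; move: gen.
  case: i zE ok => [be|j a c|j|j e] zE ok;
    try by case=> /V0 ve; rewrite ve eqxx in v0.
  case=> /V1[pv qv]; rewrite pv qv => /(scaler_injl v0) ->.
  move=> /(scaler_injl tv0) -> _.
  have [[jl _ _ _] [jl' _ _ _]] := (ok, ok').
  by rewrite (zeta_inj jl jl' (esym zE)).
- have [s1 q1 r1] := tee_module v ok'; move: gen.
  have [jl' _ /eqP g0'] := ok'.
  case: i zE ok => [be|j a c|j|j e] zE ok.
  + case=> _ _ pv _ _; case: g0'; apply: null.
    by rewrite -(pp0 n3 xi2 rel tz s1) pv lf0.
  + by case; rewrite s1 => /xv.
  + by have [jl _ _] := ok; rewrite (zeta_inj jl jl' (esym zE)).
  + have [_ /eqP ph _ _] := ok.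
    by case=> _ _ rq _; case: ph; apply: null; rewrite -rq q1 lf0.
have [jl' /eqP ph' _ ex'] := ok'; move: gen.
case: i zE ok => [be|j a c|j|j e] zE ok.
- case=> sv _ _ qv _; case: ph'; apply: null.
  by rewrite -(rq0 n3 xi2 rel tz sv) qv lf0.
- case=> sv _ _ rv; case: ph'; apply: null.
  by rewrite -(qr1 n3 xi2 rel tz sv) rv lf0.
- case=> sv _ qv _ _; case: ph'; apply: null.
  by rewrite -(rq0 n3 xi2 rel tz sv) qv lf0.
have [jl _ _ ex] := ok; have jj : j = j' by exact: (zeta_inj jl jl' (esym zE)).
subst j; case=> sv tv _; rewrite (six_module ok' sv tv) => /(scaler_injl v0).
move=> /oppr_inj/(mulfI (introN eqP ph')) => kk.
have dE : d j' = sroot j' - (hh_z j' - sroot j') by rewrite /sroot; field.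
case: e e' ok ex' kk {ex ok' v v0 null xv tv0 rel tz zE sv tv} => [] [] //=.
  by case=> _ _ _ [_ /eqP d0] _ kk; case: d0; rewrite dE; apply/eqP; rewrite subr_eq0; apply/eqP; first [exact: kk | exact: esym kk].
by move=> _ [_ /eqP d0] kk; case: d0; rewrite dE; apply/eqP; rewrite subr_eq0; apply/eqP; first [exact: kk | exact: esym kk].
Qed.

(** A vector satisfying the equations of a label yields a nonzero homomorphism
from its module, which is an isomorphism onto any simple module.  Conversely an
isomorphism between two listed modules transports such a vector, so the labels
agree by [generates_inj]. *)
Lemma classification (idx : seq (label k)) : uniq idx ->
  (forall i, i \in idx -> admissible i) ->
  (forall M : Aops k, is_Amodule l lam mu M -> is_simple M ->
     exists i (v : M), [/\ i \in idx, graded_by xi lam mu (scalar_of i) M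
                          & generates i v]) ->
  simple_modules_are l lam mu (map module_of idx) (size idx).
Proof.
move=> uniq_idx ok complete.
have isA i : i \in idx -> is_Amodule l lam mu (module_of i).
  by move=> /ok oki; have [_ _] := module_of_model oki; apply; exact: scalar_expl.
have simp i : i \in idx -> is_simple (module_of i).
  by move/ok; exact: module_of_simple.
split; first exact: size_map.
- by apply: Forall_map => i ii; split; [exact: isA | exact: simp].
- apply: ForallOrdPairs_map => // i j ii jj ij [f [f_bij fs ft fa]].
  have [i0 [v [i0i _ gen]]] := complete _ (isA i ii) (simp i ii).
  have ii0 : i0 = i by apply: generates_inj gen; exact: ok.
  rewrite ii0 in gen; case: ij; apply: (@generates_inj i j (f v)); try exact: ok.
  apply: generates_intertwine (gen); first by split.
  move: (generates_neq0 gen); apply: contra => /eqP fv.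
  by apply/eqP/(bij_inj f_bij); rewrite fv lf0.
move=> M MA Ms; have [i [v [ii gr gen]]] := complete M MA Ms.
apply: (Exists_map (i := i)) => //; have [_ sat _] := module_of_model (ok i ii).
have [e sat_e e0] := satisfies_of_generates (ok i ii) gr gen.
have [f fI fE] : exists2 f : 'Hom(module_of i, M), intertwines f &
    forall j, (j <= deg (data_of i))%N -> f (unit_vec k (deg (data_of i)) j) = e j.
  apply: (hom_of_satisfies n3 xi2 _ sat sat_e).
  case: (i) => [?|? ? ?|?|j ee] //=.
  by rewrite /well_formed; case: (six_par j ee) => [[[? ?] ?] ?].
have fv : f (unit_vec k (deg (data_of i)) 0) <> 0.
  by rewrite fE // e0; apply/eqP/(generates_neq0 gen).
exact: (isomorphic_of_simple n3 xi2 (simp i ii) Ms fI fv).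
Qed.

(** t^2 commutes with all generators, so each of its eigenspaces is a
submodule; its eigenvalues are l-th roots of unity. *)
Lemma simple_graded (M : Aops k) : is_Amodule l lam mu M -> is_simple M ->
  exists2 j, (j < l)%N & graded_by xi lam mu (zeta ^+ j) M.
Proof.
move=> MA Ms; have rel v := pqr_of_Amodule n3 xi2 v MA.
set s := op_s M; set t := op_t M.
have tl v : iter l (t \o t)%VF v = v.
  have /is_AmoduleP[tl _] := MA; rewrite -[RHS]tl.
  elim: (l) => [//|n IHn]; by rewrite mulnS iterD /= -IHn comp_lfunE.
have [v v0] := simple_nonzero Ms.
have ln0 : l%:R != 0 :> k by rewrite -(prednK l_gt0); exact: natr_neq0.
have [j [u [jl u0 tu]]] :=
  root_of_unity_eigenvector l_gt0 ln0 zeta_prim (tl v) v0.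
exists j => //; split=> [//|w].
pose U := lker (t \o t - zeta ^+ j *: \1)%VF.
have memU x : (x \in U) = (t (t x) == zeta ^+ j *: x).
  by rewrite memv_ker !(add_lfunE, opp_lfunE, scale_lfunE, comp_lfunE, id_lfunE) subr_eq0.
have st x : s (t x) = t (s (s x)) by exact: gr_st rel x.
have ts x : t (s x) = s (s (t x)) by exact: rel_ts (rel x).
apply/eqP; rewrite -memU; apply: (simple_full n3 xi2 Ms (U := U) (v := u)) => //.
  move=> x; rewrite memU => /eqP tx; split; rewrite memU -/s -/t.
  - by rewrite ts -[t (s (s _))]st tx lfZ.
  - by rewrite tx lfZ.
  - by rewrite !(gr_tp rel, lfN) opprK -/t tx lfZ.
  - by rewrite (gr_tq rel) lfN (gr_tr rel) opprK -/t tx lfZ.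
  - by rewrite (gr_tr rel) lfN (gr_tq rel) opprK -/t tx lfZ.
by rewrite memU -comp_lfunE tu.
Qed.

Lemma complete_six j (M : Aops k) : (j < l)%N -> phi_z j != 0 ->
  d j ^+ 2 = hh_z j ^+ 2 - 4 * ff_z j * gg_z j ->
  graded_by xi lam mu (zeta ^+ j) M -> is_simple M ->
  exists e (v : M), generates (Six j e) v.
Proof.
move=> jl ph dj [rel tz] Ms.
have sd := sroot_prod dj.
have [x [ka [x0 sx tx Kx kaE]]] :=
  phi_eigenvector n3 xi2 (zeta_neq0 j) rel tz Ms (b_sq jl) ph sd.
exists (ka != sroot j), x; split=> //; split=> //.
  exact: (rq0 n3 xi2 rel tz sx).
rewrite Kx /kappa; case: eqVneq kaE => [-> //|ne [kaE|-> //]].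
by rewrite kaE eqxx in ne.
Qed.

Lemma complete_degenerate j rho (M : Aops k) : (j < l)%N -> phi_z j = 0 ->
  rho ^+ 2 = lam / 3 ->
  graded_by xi lam mu (zeta ^+ j) M -> is_simple M ->
  [\/ gg_z j = 0 /\ exists be (v : M), (be = b j \/ be = - b j) /\ generates (Line be) v,
      gg_z j != 0 /\ exists v : M, generates (Tee j) v
    | exists a c (v : M), [/\ a = rho \/ a = - rho, c = rho \/ c = - rho &
        generates (Plane j a c) v]].
Proof.
move=> jl ph rho2 [rel tz] Ms.
have [[g0 [be [v [beE v0 [sv tv pv qv rv]]]]]|[g0 [v [v0 tv all0]]]|
    [a [c [v [aE cE v0 [sv pv qv rv]]]]]] :=
  degenerate_eigenvector n3 xi2 (zeta_neq0 j) rel tz Ms ph (b_sq jl) rho2.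
- apply: Or31; split=> //; exists be, v; split=> //; split=> //.
  by rewrite tz /= -(b_sq jl); case: beE => ->; rewrite ?sqrrN.
- apply: Or32; split=> //; exists v; split=> //.
  have [sv qv rv] := all0 v; have [_ qp rp] := all0 (p_op M v).
  by split=> //; split=> //; exact: (pp0 n3 xi2 rel tz sv).
- by apply: Or33; exists a, c, v; split.
Qed.

End Classification.

(** * The listed modules as monomial modules *)

Section Identification.

Variable k : closedFieldType.

Lemma extend_congr n (S S' T T' A A' : 'M[k]_n) : S = S' -> T = T' -> A = A' ->
  @extend k (mx_Gops S T) (mx_op A) = @extend k (mx_Gops S' T') (mx_op A').
Proof. by move=> -> -> ->. Qed.

Lemma zero_ext_mx n (S T : 'M[k]_n) :
  zero_ext (mx_Gops S T) = @extend k (mx_Gops S T) (mx_op 0).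
Proof.
rewrite /zero_ext; congr (extend _); apply/lfunP=> v.
by rewrite zero_lfunE lfunE /= mul0mx.
Qed.

Lemma zero_ext_line (be : k) : zero_ext (mx_Gops (1%:M : 'M_1) be%:M) = monomial_module (line be).
Proof.
rewrite zero_ext_mx; apply: extend_congr; apply/matrixP=> i j;
  by rewrite !mxE !ord1 /entry //= ?addr0.
Qed.

Lemma Lmod_plane (xi zeta : k) j a c :
  Lmod xi zeta j a c = monomial_module (plane (zeta ^+ j) xi a c).
Proof.
apply: extend_congr; apply/matrixP=> i i'; rewrite !mxE;
  case: i => [[|[|//]] ?]; case: i' => [[|[|//]] ?]; rewrite ?mxE /=; ring.
Qed.

Lemma zero_ext_Mtwo (xi zeta : k) j : zero_ext (Mtwo xi zeta j) = Lmod xi zeta j 0 0.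
Proof.
rewrite /Mtwo zero_ext_mx; apply: extend_congr => //; apply/matrixP=> i i'.
by rewrite !mxE; case: i => [[|[|//]] ?]; case: i' => [[|[|//]] ?] /=;
  rewrite ?mulr0 ?oppr0.
Qed.

Lemma Tmod_tee (zeta : k) b mu j :
  Tmod zeta b mu j = monomial_module (tee (b j) (mu * (1 - zeta ^+ j))).
Proof.
apply: extend_congr; apply/matrixP=> i i'; rewrite !mxE;
  case: i => [[|[|//]] ?]; case: i' => [[|[|//]] ?]; rewrite ?mxE /=; ring.
Qed.

Lemma Nmod_six (xi zeta : k) b lam mu j c1 c2 t1 t2 : 3 != 0 :> k -> b j != 0 ->
  Nmod xi zeta b lam mu j c1 c2 t1 t2 =
  monomial_module (six (zeta ^+ j) xi (b j) (- phi lam mu (zeta ^+ j) / b j) c1 c2 t1 t2).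
Proof.
move=> n3 b0; have n9 : 9 != 0 :> k by rewrite (_ : 9 = 3 * 3) ?mulf_neq0 //; ring.
have -> : - phi lam mu (zeta ^+ j) / b j = f_ zeta b lam mu j.
  by rewrite /phi /f_; field; rewrite b0 n3 n9.
apply: extend_congr; apply/matrixP=> i i'; rewrite !mxE;
  case: i => [[|[|[|[|[|[|//]]]]]] ?]; case: i' => [[|[|[|[|[|[|//]]]]]] ?];
  rewrite ?mxE /=; ring.
Qed.

End Identification.

Lemma uniq_flatten_map (I : Type) (J : eqType) (K : eqType) (g : K -> seq J)
    (key : J -> K) (s : seq K) :
  uniq s -> (forall i, uniq (g i)) -> (forall i x, x \in g i -> key x = i) ->
  uniq (flatten [seq g i | i <- s]).
Proof.
move=> us ug keyg; elim: s us => //= i s IHs /andP[nis us].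
rewrite cat_uniq ug IHs // andbT; apply/hasPn => x /flatten_mapP[i' i's xi'].
by apply: contra nis => /keyg <-; rewrite (keyg _ _ xi').
Qed.

Lemma size_flatten_map (J K : Type) (g : K -> seq J) n (s : seq K) :
  (forall i, size (g i) = n) -> size (flatten [seq g i | i <- s]) = (n * size s)%N.
Proof.
by move=> sg; elim: s => [|i s IHs] /=; rewrite ?muln0 // size_cat sg IHs mulnS.
Qed.

(** * The parameter cases *)

Section Cases.

Variables (k : closedFieldType) (char0 : [pchar k] =i pred0).
Variables (l : nat) (l_gt1 : (1 < l)%N).
Variables (xi zeta : k) (xi_prim : 3.-primitive_root xi).
Variable (zeta_prim : l.-primitive_root zeta).
Variables (b : nat -> k) (b_sq : forall j, (j < l)%N -> b j ^+ 2 = zeta ^+ j).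
Variables (b_0 : b 0%N = 1) (lam mu r : k) (r_sq : r ^+ 2 = lam / 3).

Let l_gt0 : (0 < l)%N := ltnW l_gt1.
Let n2 : 2 != 0 :> k := natr_neq0 char0 1.
Let n3 : 3 != 0 :> k := natr_neq0 char0 2.
Let n9 : 9 != 0 :> k := natr_neq0 char0 8.

Lemma xi_quadratic : xi ^+ 2 = - 1 - xi.
Proof.
have x1 : xi != 1.
  by have := prim_order_dvd xi_prim 1; rewrite expr1 => <-.
have : (xi - 1) * (xi ^+ 2 + xi + 1) = 0.
  have -> : (xi - 1) * (xi ^+ 2 + xi + 1) = xi ^+ 3 - 1 by ring.
  by rewrite (prim_expr_order xi_prim) subrr.
move/eqP; rewrite mulf_eq0 subr_eq0 (negPf x1) /= => /eqP e.
by rewrite -[RHS]addr0 -e; ring.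
Qed.

Let xi2 := xi_quadratic.
Let J := iota 1 l.-1.
Let J0 := iota 0 l.

Lemma mem_J j : (j \in J) = (0 < j < l)%N.
Proof. by rewrite mem_iota add1n prednK. Qed.

Lemma mem_J0 j : (j \in J0) = (j < l)%N.
Proof. by rewrite mem_iota. Qed.

Lemma zeta_neq1 j : (0 < j < l)%N -> zeta ^+ j != 1.
Proof.
case/andP=> j0 jl; rewrite -(prim_order_dvd zeta_prim).
by rewrite gtnNdvd.
Qed.

Lemma one_neq_opp (x : k) : x != 0 -> x != - x.
Proof.
move=> x0; rewrite -subr_eq0 opprK -mulr2n -mulr_natl mulf_neq0 //.
Qed.

Local Notation phi_z j := (phi lam mu (zeta ^+ j)).
Local Notation gg_z j := (gg lam mu (zeta ^+ j)).

Definition quad j (r : k) := [:: Plane j r r; Plane j r (- r); Plane j (- r) r; Plane j (- r) (- r)].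

Lemma quad_uniq j : lam != 0 -> uniq (quad j r).
Proof.
move=> l0; have r0 : r != 0.
  apply: contra l0 => /eqP r0; move: r_sq; rewrite r0 expr0n /= => /esym/eqP.
  by rewrite mulf_eq0 invr_eq0 (negPf n3) orbF.
have nr := negPf (one_neq_opp r0).
have inj x y x' y' : (Plane j x y == Plane j x' y') = (x == x') && (y == y').
  apply/eqP/andP => [[-> ->]|[/eqP-> /eqP->] //]; by rewrite !eqxx.
by rewrite /= !inE !inj !eqxx ![- r == r]eq_sym nr.
Qed.

Section Generic.

Variable d : nat -> k.
Local Notation module_of := (module_of xi zeta b lam mu d).

Lemma four_L_quad j : four_L xi zeta j r = map module_of (quad j r).
Proof. by rewrite /four_L /= !Lmod_plane. Qed.

Lemma L0_lines : [:: zero_ext (Splus b 0); zero_ext (Sminus b 0)] =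
  map module_of [:: Line 1; Line (- 1)].
Proof. by rewrite /Splus /Sminus !zero_ext_line b_0. Qed.

Lemma Splus_line j : zero_ext (Splus b j) = module_of (Line (b j)).
Proof. exact: zero_ext_line. Qed.

Lemma Sminus_line j : zero_ext (Sminus b j) = module_of (Line (- b j)).
Proof. exact: zero_ext_line. Qed.

Lemma Mtwo_plane j : zero_ext (Mtwo xi zeta j) = module_of (Plane j 0 0).
Proof. by rewrite zero_ext_Mtwo Lmod_plane. Qed.

(** When phi = 0, the entry mu (1 - zeta^j) equals g_j. *)
Lemma Tmod_label j : phi_z j = 0 -> Tmod zeta b mu j = module_of (Tee j).
Proof.
move=> ph; rewrite Tmod_tee /module_of /= (_ : gg _ _ _ = mu * (1 - zeta ^+ j)) //.
have -> : gg lam mu (zeta ^+ j) = mu * (1 - zeta ^+ j) - 2 * phi_z j.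
  by rewrite /gg /phi; field; rewrite n3 n9.
by rewrite ph mulr0 subr0.
Qed.

Lemma admissible_one x : x ^+ 2 = 1 ->
  admissible l zeta lam mu d (Line x).
Proof. by move=> x1; split; rewrite x1 ?expr1n ?mulr1. Qed.

End Generic.

Lemma b_eq i j : (i < l)%N -> (j < l)%N -> b i ^+ 2 = b j ^+ 2 -> i = j.
Proof. by move=> il jl; rewrite !b_sq //; exact: (zeta_inj zeta_prim il jl). Qed.

Lemma case_zero : lam = 0 /\ mu = 0 ->
  simple_modules_are l lam mu
     [seq zero_ext V | V <- [seq Splus b j | j <- J0]
                            ++ [seq Sminus b j | j <- J0]
                            ++ [seq Mtwo xi zeta j | j <- J0]]
     (3 * l).
Proof.
case=> lam0 mu0; pose d (j : nat) : k := 0.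
pose idx := [seq Line (b j) | j <- J0] ++ [seq Line (- b j) | j <- J0]
  ++ [seq Plane j 0 0 | j <- J0].
have -> : [seq zero_ext V | V <- [seq Splus b j | j <- J0]
     ++ [seq Sminus b j | j <- J0] ++ [seq Mtwo xi zeta j | j <- J0]] =
     map (module_of xi zeta b lam mu d) idx.
  rewrite /idx !map_cat -!map_comp; congr (_ ++ (_ ++ _)); apply: eq_map => j /=;
  [exact: Splus_line | exact: Sminus_line | exact: Mtwo_plane].
have <- : size idx = (3 * l)%N.
  by rewrite /idx !size_cat !size_map size_iota !mulSn mul0n addn0.
have ph j : phi_z j = 0 by rewrite /phi lam0 mu0 !mul0r subrr !mul0r.
have g0 j : gg_z j = 0 by rewrite /gg lam0 mu0 !mulr0 addr0 !mul0r.
have bn j : (j < l)%N -> b j != 0 by exact: (b_neq0 l_gt0 zeta_prim b_sq).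
apply: (classification char0 l_gt0 xi2 zeta_prim b_sq).
- rewrite !cat_uniq !map_inj_in_uniq ?iota_uniq //=; last first.
  + by move=> i j; rewrite !mem_J0 => il jl [] /(congr1 (fun x => x ^+ 2)) /b_eq; exact.
  + by move=> i j; rewrite !mem_J0 => il jl [] /(congr1 (fun x => x ^+ 2));
      rewrite !sqrrN => /b_eq; exact.
  + by move=> i j _ _ [].
  rewrite andbT has_cat negb_or -andbA; apply/and3P; split.
  + apply/hasPn => _ /mapP[i il ->]; apply/negP => /mapP[j jl [] e].
    rewrite !mem_J0 in il jl; have ij : i = j.
      by apply: b_eq => //; rewrite -e sqrrN.
    by move: (one_neq_opp (bn _ il)); rewrite e ij eqxx.
  + by apply/hasPn => _ /mapP[i il ->]; apply/negP => /mapP[].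
  + by apply/hasPn => _ /mapP[i il ->]; apply/negP => /mapP[].
- move=> i; rewrite !mem_cat => /or3P[] /mapP[j]; rewrite mem_J0 => jl ->.
  + by split; rewrite ?lam0 ?mu0 ?mul0r // b_sq // zeta_expl.
  + by split; rewrite ?lam0 ?mu0 ?mul0r // sqrrN b_sq // zeta_expl.
  + by split; rewrite ?ph // expr0n lam0 mul0r.
move=> M MA Ms; have [j jl gr] := simple_graded char0 l_gt0 xi2 zeta_prim MA Ms.
have rho2 : 0 ^+ 2 = lam / 3 by rewrite expr0n lam0 mul0r.
have [[_ [be [v [beE gen]]]]|[ng]|[a [c [v [aE cE gen]]]]] :=
  complete_degenerate char0 l_gt0 xi2 zeta_prim d b_sq jl (ph j) rho2 gr Ms.
- exists (Line be), v; rewrite /= !mem_cat; split=> //.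
    by case: beE => ->; rewrite map_f ?mem_J0 ?orbT.
  by case: beE => ->; rewrite ?sqrrN b_sq.
- by rewrite g0 eqxx in ng.
exists (Plane j a c), v; split=> //; rewrite !mem_cat.
rewrite oppr0 in aE cE; have [-> ->] : a = 0 /\ c = 0 by case: aE cE => -> [].
by rewrite (map_f (fun j => Plane j 0 0)) ?orbT ?mem_J0.
Qed.

Lemma mem_quad j a c : (a = r \/ a = - r) -> (c = r \/ c = - r) ->
  Plane j a c \in quad j r.
Proof. by case=> -> []->; rewrite !inE eqxx ?orbT. Qed.

Lemma quadP j i : i \in quad j r ->
  exists a c, [/\ i = Plane j a c, a ^+ 2 = lam / 3 & c ^+ 2 = lam / 3].
Proof.
by rewrite !inE => /or4P[] /eqP ->; do 2!eexists; split; rewrite ?sqrrN //.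
Qed.

Lemma b0_line be : be = b 0%N \/ be = - b 0%N ->
  Line be \in [:: Line 1; Line (-1)] /\ be ^+ 2 = 1.
Proof. by rewrite b_0 => -[] ->; rewrite !inE eqxx ?orbT ?sqrrN expr1n. Qed.

Lemma case_third : mu = lam / 3 /\ lam / 3 <> 0 ->
  simple_modules_are l lam mu
      ([:: zero_ext (Splus b 0); zero_ext (Sminus b 0)]
         ++ flatten [seq four_L xi zeta j r | j <- J0]
         ++ [seq Tmod zeta b mu j | j <- J])
     (5 * l + 1).
Proof.
case=> muE l3; pose d (j : nat) : k := 0.
have l0 : lam != 0 by apply/negP => /eqP l0; rewrite l0 mul0r in l3.
have ph j : phi_z j = 0 by rewrite /phi muE subrr !mul0r.
have gE j : gg_z j = lam / 3 * (1 - zeta ^+ j).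
  by rewrite /gg muE; field; rewrite n3 n9.
have gJ j : (0 < j < l)%N -> gg_z j != 0.
  move=> jJ; rewrite gE mulf_neq0 //; first exact/eqP.
  by rewrite subr_eq0 eq_sym zeta_neq1.
pose idx := [:: Line 1; Line (- 1)] ++ flatten [seq quad j r | j <- J0]
  ++ [seq Tee j | j <- J].
set mods := (mods in simple_modules_are _ _ _ mods _).
have -> : mods = map (module_of xi zeta b lam mu d) idx.
  rewrite /mods /idx !map_cat (L0_lines d) map_flatten -!map_comp.
  congr (_ ++ (flatten _ ++ _)); apply: eq_map => j; first exact: four_L_quad.
  exact: Tmod_label.
have <- : size idx = (5 * l + 1)%N.
  rewrite /idx !size_cat (size_flatten_map (n := 4)) // size_map !size_iota /=.
  by case: (l) l_gt0 => // n _; ring.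
apply: (classification char0 l_gt0 xi2 zeta_prim b_sq).
- rewrite !cat_uniq map_inj_uniq ?iota_uniq; last by move=> i j [].
  rewrite (@uniq_flatten_map nat _ _ _
    (fun i => if i is Plane j _ _ then j else 0%N)) ?iota_uniq //; first last.
  + by move=> j i /quadP[a [c [-> _ _]]].
  + by move=> j; exact: quad_uniq.
  rewrite /= !andbT inE; apply/and3P; split.
  + apply/eqP => -[] /eqP; apply/negP; exact/one_neq_opp/oner_neq0.
  + apply/hasPn => i; rewrite mem_cat => /orP[/flatten_mapP[j _ /quadP[a [c [-> _ _]]]]|/mapP[j _ ->]];
    by rewrite !inE.
  + by apply/hasPn => _ /mapP[j _ ->]; apply/negP => /flatten_mapP[j' _ /quadP[a [c []]]].
- move=> i; rewrite !mem_cat => /or3P[|/flatten_mapP[j]|/mapP[j]].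
  + by rewrite !inE => /orP[] /eqP ->; apply: admissible_one; rewrite ?sqrrN expr1n.
  + by rewrite mem_J0 => jl /quadP[a [c [-> a2 c2]]]; split.
  + by rewrite mem_J => /andP[j0 jl] ->; split; rewrite ?gJ ?j0.
move=> M MA Ms; have [j jl gr] := simple_graded char0 l_gt0 xi2 zeta_prim MA Ms.
have [[g0 [be [v [beE gen]]]]|[ng [v gen]]|[a [c [v [aE cE gen]]]]] :=
  complete_degenerate char0 l_gt0 xi2 zeta_prim d b_sq jl (ph j) r_sq gr Ms.
- have j0 : j = 0%N.
    by case: (posnP j) => // j0; have := gJ j; rewrite j0 jl g0 eqxx => /(_ isT).
  rewrite j0 in beE gr; have [Lbe be2] := b0_line beE.
  by exists (Line be), v; rewrite /= be2 mem_cat Lbe.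
- exists (Tee j), v; split=> //; rewrite !mem_cat map_f ?orbT // mem_J jl andbT lt0n.
  by apply: contra ng => /eqP ->; rewrite gE subrr mulr0.
exists (Plane j a c), v; split=> //; rewrite !mem_cat.
apply/or3P/Or32/flatten_mapP; exists j; rewrite ?mem_J0 //; exact: mem_quad.
Qed.

(** The common part of the cases with mu different from lam/3: [P] lists the
modules L_0(a,c) and [S] the modules N_j.  The last hypothesis allows for a j
at which both values of [e] give the same equations. *)
Lemma case_six (d : nat -> k) (P S : seq (label k)) : mu <> lam / 3 ->
  uniq P -> uniq S ->
  (forall i, i \in P ->
     exists a c, [/\ i = Plane 0 a c, a ^+ 2 = lam / 3 & c ^+ 2 = lam / 3]) ->
  (forall a c, (a = r \/ a = - r) -> (c = r \/ c = - r) -> Plane 0 a c \in P) ->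
  (forall i, i \in S -> exists j e, i = Six j e) ->
  (forall i, i \in S -> admissible l zeta lam mu d i) ->
  (forall j, (0 < j < l)%N ->
     d j ^+ 2 = hh lam mu (zeta ^+ j) ^+ 2 - 4 * ff lam mu (zeta ^+ j) * gg_z j) ->
  (forall j e (M : Aops k) (v : M), (0 < j < l)%N ->
     generates xi zeta b lam mu d (Six j e) v ->
     exists e', Six j e' \in S /\ generates xi zeta b lam mu d (Six j e') v) ->
  simple_modules_are l lam mu
    ([:: zero_ext (Splus b 0); zero_ext (Sminus b 0)]
       ++ map (module_of xi zeta b lam mu d) P
       ++ map (module_of xi zeta b lam mu d) S) (2 + (size P + size S)).
Proof.
move=> muE uP uS PE Pr SE Sok dE gS.
have ph0 : phi_z 0%N = 0 by rewrite /phi expr0 subrr mulr0 mul0r.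
have g0 : gg_z 0%N = 0 by rewrite /gg expr0 subrr mulr0 mul0r.
have phJ j : (0 < j < l)%N -> phi_z j != 0.
  move=> jJ; rewrite /phi !mulf_neq0 ?invr_eq0 // subr_eq0; first exact/eqP.
  by rewrite eq_sym zeta_neq1.
pose idx := [:: Line 1; Line (- 1)] ++ P ++ S.
set mods := (mods in simple_modules_are _ _ _ mods _).
have -> : mods = map (module_of xi zeta b lam mu d) idx.
  by rewrite /mods /idx !map_cat (L0_lines d).
have <- : size idx = (2 + (size P + size S))%N by rewrite /idx !size_cat.
apply: (classification char0 l_gt0 xi2 zeta_prim b_sq).
- rewrite !cat_uniq uP uS /= !andbT inE; apply/and3P; split.
  + apply/eqP => -[] /eqP; apply/negP; exact/one_neq_opp/oner_neq0.
  + apply/hasPn => i; rewrite mem_cat => /orP[/PE[a [c [-> _ _]]]|/SE[j [e ->]]];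
    by rewrite !inE.
  + by apply/hasPn => i /SE[j [e ->]]; apply/negP => /PE[a [c []]].
- move=> i; rewrite !mem_cat => /or3P[|/PE[a [c [-> a2 c2]]]|/Sok //].
  + by rewrite !inE => /orP[] /eqP ->; apply: admissible_one; rewrite ?sqrrN expr1n.
  + by split.
move=> M MA Ms; have [j jl gr] := simple_graded char0 l_gt0 xi2 zeta_prim MA Ms.
have [j0|j_gt0] := posnP j; last first.
  have jJ : (0 < j < l)%N by rewrite j_gt0.
  have [e [v gen]] :=
    complete_six char0 l_gt0 xi2 zeta_prim b_sq jl (phJ j jJ) (dE j jJ) gr Ms.
  have [e' [Se' gen']] := gS _ _ _ _ jJ gen.
  by exists (Six j e'), v; rewrite !mem_cat Se' !orbT.
rewrite {j}j0 in jl gr.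
have [[_ [be [v [beE gen]]]]|[ng _]|[a [c [v [aE cE gen]]]]] :=
  complete_degenerate char0 l_gt0 xi2 zeta_prim d b_sq jl ph0 r_sq gr Ms.
- have [Lbe be2] := b0_line beE.
  by exists (Line be), v; rewrite /= be2 mem_cat Lbe.
- by rewrite g0 eqxx in ng.
by exists (Plane 0 a c), v; rewrite !mem_cat Pr ?orbT.
Qed.

End Cases.

(** * The discriminant *)

Section Discriminant.

Variables (k : closedFieldType) (char0 : [pchar k] =i pred0).
Variables (l : nat) (l_gt1 : (1 < l)%N).
Variables (xi zeta : k) (xi_prim : 3.-primitive_root xi).
Variable (zeta_prim : l.-primitive_root zeta).
Variables (b : nat -> k) (b_sq : forall j, (j < l)%N -> b j ^+ 2 = zeta ^+ j).
Variables (lam mu : k).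
Variables (q : nat -> k)
  (q_sq : forall j, (0 < j < l)%N -> q j ^+ 2 = b j ^+ 4 + b j ^+ 2 + 1).
Variables (d : nat -> k)
  (d_sq : forall j, (0 < j < l)%N ->
     d j ^+ 2 = h_ b lam mu j ^+ 2
                - 4 * fplus zeta lam mu j * g_ zeta lam mu j)
  (d_h : forall j, (0 < j < l)%N ->
     fplus zeta lam mu j * g_ zeta lam mu j = 0 -> d j = h_ b lam mu j).

Let l_gt0 : (0 < l)%N := ltnW l_gt1.
Let n2 : 2 != 0 :> k := natr_neq0 char0 1.
Let n3 : 3 != 0 :> k := natr_neq0 char0 2.
Let n9 : 9 != 0 :> k := natr_neq0 char0 8.

(** Three times h_j^2 - 4 f_(+j) g_j is the opposite of this polynomial at
z = zeta^j. *)
Definition disc (z : k) :=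
  (mu + lam / 3) ^+ 2 * (1 - z) ^+ 2 - 4 * (lam / 3) ^+ 2 * (z ^+ 2 + z + 1).

Lemma h_hh j : (j < l)%N -> h_ b lam mu j = hh lam mu (zeta ^+ j).
Proof. by move=> jl; rewrite /h_ /hh b_sq. Qed.

Lemma d_label j : (0 < j < l)%N ->
  d j ^+ 2 = hh lam mu (zeta ^+ j) ^+ 2
    - 4 * ff lam mu (zeta ^+ j) * gg lam mu (zeta ^+ j).
Proof. by move=> jJ; rewrite d_sq // h_hh //; case/andP: jJ. Qed.

Lemma d_disc j : (0 < j < l)%N -> d j ^+ 2 = - (disc (zeta ^+ j) / 3).
Proof.
move=> jJ; rewrite d_label // /disc /hh /ff /gg; field.
by rewrite n3 n9.
Qed.

(** The polynomial splits over q_j, a square root of z^2 + z + 1, and each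
factor is linear in mu. *)
Lemma mu_is_cP j : (0 < j < l)%N ->
  mu_is_c b lam mu q j <-> disc (zeta ^+ j) = 0.
Proof.
move=> jJ; have z1 := zeta_neq1 zeta_prim jJ; have [_ jl] := andP jJ.
have n1z : zeta ^+ j - 1 != 0 by rewrite subr_eq0.
have qq : q j ^+ 2 = (zeta ^+ j) ^+ 2 + zeta ^+ j + 1.
  by rewrite q_sq // -(b_sq jl); ring.
pose y := (mu + lam / 3) * (zeta ^+ j - 1).
have factor : disc (zeta ^+ j) =
    (y - 2 * q j * (lam / 3)) * (y + 2 * q j * (lam / 3)).
  have -> : (y - 2 * q j * (lam / 3)) * (y + 2 * q j * (lam / 3))
    = y ^+ 2 - 4 * (lam / 3) ^+ 2 * q j ^+ 2 by field.
  by rewrite qq /disc /y; field.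
have root (e : k) : (mu = c_ b e j * (lam / 3)) <-> y - 2 * e * (lam / 3) = 0.
  have -> : y - 2 * e * (lam / 3) =
      (mu - c_ b e j * (lam / 3)) * (zeta ^+ j - 1).
    by rewrite /y /c_ b_sq //; field; rewrite n1z n3.
  split=> [<-|/eqP]; first by rewrite subrr mul0r.
  by rewrite mulf_eq0 (negPf n1z) orbF subr_eq0 => /eqP.
have rootN : y + 2 * q j * (lam / 3) = y - 2 * (- q j) * (lam / 3) by ring.
rewrite factor rootN; split.
  by case=> /root ->; rewrite ?mul0r ?mulr0.
by move/eqP; rewrite mulf_eq0 => /orP[] /eqP /root; [left | right].
Qed.

Lemma d_neq0 j : (0 < j < l)%N -> ~ mu_is_c b lam mu q j -> d j != 0.
Proof.
move=> jJ nc; apply/negP => /eqP d0; apply: nc; apply/mu_is_cP => //.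
have := d_disc jJ; rewrite d0 expr0n /= => /eqP.
by rewrite eq_sym oppr_eq0 mulf_eq0 invr_eq0 (negPf n3) orbF => /eqP.
Qed.

Lemma sroot_neq0 j : (0 < j < l)%N -> d j != 0 -> sroot zeta lam mu d j != 0.
Proof.
move=> jJ d0; have := sroot_prod char0 (d_label jJ).
have [s0|//] := eqVneq (sroot zeta lam mu d j) 0.
rewrite s0 mul0r => /esym fg; have dh := d_h jJ fg; have [_ jl] := andP jJ.
move: s0; rewrite /sroot -h_hh // -dh => /eqP; rewrite mulf_eq0 invr_eq0.
by rewrite (negPf n2) orbF -mulr2n -mulr_natl mulf_eq0 (negPf n2) (negPf d0).
Qed.

Lemma admissible_six j e : (0 < j < l)%N -> mu <> lam / 3 ->
  ~ mu_is_c b lam mu q j -> admissible l zeta lam mu d (Six j e).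
Proof.
move=> jJ muE nc; have d0 := d_neq0 jJ nc; have s0 := sroot_neq0 jJ d0.
have [_ jl] := andP jJ; split=> //.
- rewrite /phi !mulf_neq0 ?invr_eq0 // subr_eq0; first exact/eqP.
  by rewrite eq_sym (zeta_neq1 zeta_prim).
- exact: d_label.
by case: e; [|right].
Qed.

Lemma N1_label j : (0 < j < l)%N ->
  N1 xi zeta b lam mu d j = module_of xi zeta b lam mu d (Six j false).
Proof.
case/andP=> j0 jl; have b0 := b_neq0 l_gt0 zeta_prim b_sq jl.
rewrite /N1 /module_of /= /exceptional b_sq //.
by case: ifP => _; rewrite Nmod_six // /s_ h_hh.
Qed.

Lemma N2_label j : (0 < j < l)%N ->
  N2 xi zeta b lam mu d j = module_of xi zeta b lam mu d (Six j true).
Proof.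
case/andP=> j0 jl; have b0 := b_neq0 l_gt0 zeta_prim b_sq jl.
by rewrite /N2 /module_of /= Nmod_six // /s_ h_hh.
Qed.

(** z^2 disc(1/z) = disc(z), so l - j has the same property as j.  Hence
l - j = j and zeta^j = -1, where disc is 4 mu (mu + 2 lam/3). *)
Lemma unique_exceptional j : (0 < j < l)%N -> mu_is_c b lam mu q j ->
  (forall i, (0 < i < l)%N -> mu_is_c b lam mu q i -> i = j) -> mu <> 0 ->
  exceptional zeta lam mu j.
Proof.
move=> jJ cj uniq_j mu0; have [j0 jl] := andP jJ.
have z0 := zeta_neq0 l_gt0 zeta_prim j.
have zinv : zeta ^+ (l - j) = (zeta ^+ j)^-1.
  apply: (mulfI z0); rewrite mulfV // -exprD subnKC ?(ltnW jl) //.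
  exact: prim_expr_order zeta_prim.
have jJ' : (0 < l - j < l)%N by rewrite subn_gt0 jl ltn_subrL j0 l_gt0.
have discj : disc (zeta ^+ j) = 0 by apply/mu_is_cP.
have jj : (l - j)%N = j.
  apply: uniq_j => //; apply/mu_is_cP => //; rewrite zinv.
  have -> : disc (zeta ^+ j)^-1 = disc (zeta ^+ j) / (zeta ^+ j) ^+ 2.
    by rewrite /disc; field; rewrite z0 n3.
  by rewrite discj mul0r.
have zN1 : zeta ^+ j = - 1.
  have : (zeta ^+ j - 1) * (zeta ^+ j + 1) = 0.
    have -> : (zeta ^+ j - 1) * (zeta ^+ j + 1) = zeta ^+ j * zeta ^+ j - 1 by ring.
    by rewrite -{2}jj zinv mulfV // subrr.
  move/eqP; rewrite mulf_eq0 subr_eq0 (negPf (zeta_neq1 zeta_prim jJ)) /=.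
  by rewrite addr_eq0 => /eqP.
rewrite /exceptional zN1 eqxx andbT.
have : 4 * mu * (mu + 2 * (lam / 3)) = 0 by rewrite -discj zN1 /disc; ring.
move/eqP; rewrite !mulf_eq0 (negPf (natr_neq0 char0 3)) /=.
have /negPf -> : mu != 0 by apply/eqP.
by rewrite /= addr_eq0 mulNr.
Qed.

End Discriminant.

(** * The theorem *)

Theorem theorem3p29
  (k : closedFieldType) (char0 : [pchar k] =i pred0)
  (l : nat) (l_gt1 : (1 < l)%N)
  (xi zeta : k) (xi_prim : 3.-primitive_root xi)
  (zeta_prim : l.-primitive_root zeta)
  (b : nat -> k) (b_sq : forall j, (j < l)%N -> b j ^+ 2 = zeta ^+ j)
  (b_0 : b 0%N = 1)
  (lam mu : k)
  (r : k) (r_sq : r ^+ 2 = lam / 3)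
  (q : nat -> k)
  (q_sq : forall j, (0 < j < l)%N -> q j ^+ 2 = b j ^+ 4 + b j ^+ 2 + 1)
  (d : nat -> k)
  (d_sq : forall j, (0 < j < l)%N ->
     d j ^+ 2 = h_ b lam mu j ^+ 2
                - 4 * fplus zeta lam mu j * g_ zeta lam mu j)
  (d_h : forall j, (0 < j < l)%N ->
     fplus zeta lam mu j * g_ zeta lam mu j = 0 -> d j = h_ b lam mu j) :
  let J := iota 1 l.-1 in
  let J0 := iota 0 l in
  let L0 := [:: zero_ext (Splus b 0); zero_ext (Sminus b 0)] in
  let N1 := N1 xi zeta b lam mu d in
  let N2 := N2 xi zeta b lam mu d in
  (* (1) *)
  (lam = 0 /\ mu = 0 ->
   simple_modules_are l lam mu
     [seq zero_ext V | V <- [seq Splus b j | j <- J0]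
                            ++ [seq Sminus b j | j <- J0]
                            ++ [seq Mtwo xi zeta j | j <- J0]]
     (3 * l)) /\
  (* (2) *)
  (mu = lam / 3 /\ lam / 3 <> 0 ->
   simple_modules_are l lam mu
     (L0 ++ flatten [seq four_L xi zeta j r | j <- J0]
         ++ [seq Tmod zeta b mu j | j <- J])
     (5 * l + 1)) /\
  (* (3) *)
  (mu <> lam / 3 ->
   (* (a) *)
   (lam <> 0 /\ (forall j, j \in J -> ~ mu_is_c b lam mu q j) ->
    simple_modules_are l lam mu
      (L0 ++ four_L xi zeta 0 r
          ++ flatten [seq [:: N1 j; N2 j] | j <- J])
      (2 * l + 4)) /\
   (* (b) *)
   (forall j, j \in J -> mu_is_c b lam mu q j ->
    (forall i, i \in J -> mu_is_c b lam mu q i -> i = j) -> mu <> 0 ->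
    simple_modules_are l lam mu
      (L0 ++ four_L xi zeta 0 r
          ++ N1 j :: flatten [seq [:: N1 i; N2 i] | i <- J & i != j])
      (2 * l + 3)) /\
   (* (c) *)
   (lam = 0 /\ mu <> 0 ->
    simple_modules_are l lam mu
      (L0 ++ Lmod xi zeta 0 0 0
          :: flatten [seq [:: N1 j; N2 j] | j <- J])
      (2 * l + 1))).
Proof.
move=> J J0 L0 N1f N2f; have l_gt0 : (0 < l)%N := ltnW l_gt1.
split; first exact: (case_zero char0 l_gt1 xi_prim zeta_prim b_sq).
split; first exact: (case_third char0 l_gt1 xi_prim zeta_prim b_sq b_0 r_sq).
move=> mu_third.
have memJ j : (j \in J) = (0 < j < l)%N := mem_J l_gt1 j.
have N1E j : j \in J -> N1f j = module_of xi zeta b lam mu d (Six j false).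
  by rewrite memJ => jJ; exact: (N1_label char0 l_gt1 _ zeta_prim b_sq).
have N2E j : j \in J -> N2f j = module_of xi zeta b lam mu d (Six j true).
  by rewrite memJ => jJ; exact: (N2_label char0 l_gt1 _ zeta_prim b_sq).
have dE j : (0 < j < l)%N -> d j ^+ 2 = hh lam mu (zeta ^+ j) ^+ 2
    - 4 * ff lam mu (zeta ^+ j) * gg lam mu (zeta ^+ j).
  exact: (d_label b_sq d_sq).
have okS j e : j \in J -> ~ mu_is_c b lam mu q j ->
    admissible l zeta lam mu d (Six j e).
  rewrite memJ => jJ.
  exact: (admissible_six char0 zeta_prim b_sq q_sq d_sq d_h e jJ mu_third).
pose pair j := [:: @Six k j false; Six j true].
have pairE s : {subset s <= J} -> flatten [seq [:: N1f j; N2f j] | j <- s] =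
    map (module_of xi zeta b lam mu d) (flatten [seq pair j | j <- s]).
  move=> sJ; rewrite map_flatten -map_comp; congr flatten.
  by apply/eq_in_map => j /sJ jJ; rewrite N1E // N2E.
have pair_uniq s : uniq s -> uniq (flatten [seq pair j | j <- s]).
  move=> us; apply: (@uniq_flatten_map nat _ _ _
    (fun i => if i is Six j _ then j else 0%N)) => //.
    by move=> j; rewrite /= !inE andbT; apply/eqP => -[].
  by move=> j i; rewrite !inE => /orP[] /eqP ->.
have pairP s i : i \in flatten [seq pair j | j <- s] ->
    exists j e, i = Six j e /\ j \in s.
  case/flatten_mapP=> j js; rewrite !inE => /orP[] /eqP ->;
  by [exists j, false | exists j, true].
have mem_pair s j e : j \in s -> Six j e \in flatten [seq pair j | j <- s].
  by move=> js; apply/flatten_mapP; exists j => //; case: e; rewrite !inE eqxx ?orbT.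
have pair_size s : size (flatten [seq pair j | j <- s]) = (2 * size s)%N.
  by rewrite (size_flatten_map (n := 2)).
have sizeJ : size J = l.-1 by rewrite size_iota.
have uJ : uniq J by exact: iota_uniq.
have six := case_six char0 l_gt1 xi_prim zeta_prim b_sq b_0 r_sq mu_third.
have quad_ok i : i \in quad 0 r ->
    exists a c, [/\ i = Plane 0 a c, a ^+ 2 = lam / 3 & c ^+ 2 = lam / 3].
  exact: (quadP r_sq).
split; [|split].
- case=> /eqP lam0 nc; rewrite pairE // (four_L_quad xi zeta b lam mu r d).
  have -> : (2 * l + 4 = 2 + (size (quad 0 r)
      + size (flatten [seq pair j | j <- J])))%N.
    by rewrite pair_size sizeJ; case: (l) l_gt0 => // n _; rewrite /=; ring.
  apply: six => //.
  + exact: (quad_uniq char0 r_sq).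
  + exact: pair_uniq.
  + by move=> a c; exact: mem_quad.
  + by move=> i /pairP[j [e [-> _]]]; exists j, e.
  + by move=> i /pairP[j [e [-> jJ]]]; apply: okS => //; exact: nc.
  + by move=> j e M v jJ gen; exists e; split=> //; rewrite mem_pair // memJ.
- move=> j jJ cj uniq_j mu0.
  have jJ' : (0 < j < l)%N by rewrite -memJ.
  have exc : exceptional zeta lam mu j.
    apply: (unique_exceptional char0 l_gt1 zeta_prim b_sq q_sq jJ' cj) => //.
    by move=> i iJ; apply: uniq_j; rewrite memJ.
  have lam0 : lam != 0.
    apply/eqP => l0; have /andP[/eqP muE _] := exc.
    by rewrite l0 mul0r mulr0 in muE.
  pose s := [seq i <- J | i != j].
  have sJ : {subset s <= J} by move=> i; rewrite mem_filter => /andP[].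
  have us : uniq s by rewrite filter_uniq.
  have okj : admissible l zeta lam mu d (Six j false).
    have [_ jl] := andP jJ'; split=> //; [|exact: dE|by left].
    rewrite /phi !mulf_neq0 ?invr_eq0 ?(natr_neq0 char0) // subr_eq0.
      exact/eqP.
    by rewrite eq_sym (zeta_neq1 zeta_prim).
  rewrite N1E // pairE // (four_L_quad xi zeta b lam mu r d).
  have -> : (2 * l + 3 = 2 + (size (quad 0 r)
      + size (Six j false :: flatten [seq pair i | i <- s])))%N.
    have sizes : size s = l.-2.
      rewrite /s size_filter; have := count_predC (pred1 j) J.
      by rewrite (count_uniq_mem _ uJ) jJ sizeJ add1n => <-.
    rewrite /= pair_size sizes; case: (l) l_gt1 => [|[|n]] // _; rewrite /=; ring.
  apply: (six d (quad 0 r) (Six j false :: flatten [seq pair i | i <- s])) => //.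
  + exact: (quad_uniq char0 r_sq).
  + rewrite /= pair_uniq // andbT; apply/negP => /pairP[i [e [[<- _]]]].
    by rewrite mem_filter eqxx.
  + by move=> a c; exact: mem_quad.
  + by move=> i; rewrite inE => /orP[/eqP->|/pairP[i' [e [-> _]]]]; do 2!eexists.
  + move=> i; rewrite inE => /orP[/eqP-> //|/pairP[i' [e [-> i's]]]].
    apply: okS; first exact: sJ.
    move=> ci; have := uniq_j _ (sJ _ i's) ci.
    by move: i's; rewrite mem_filter => /andP[/eqP].
  + move=> i e M v iJ gen; have [ij|nij] := eqVneq i j; last first.
      by exists e; split=> //; rewrite inE mem_pair ?orbT // mem_filter nij memJ.
    (* Here h_j = s_j = 0, so both values of e give the same equations. *)
    exists false; rewrite ij mem_head; split=> //; rewrite ij in gen.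
    case: e gen => // -[v0 tv [sv tv' rq Kv]]; split=> //; split=> //.
    have [hj _ _ sj] := exceptional_values char0 (dE j jJ') exc.
    by rewrite Kv /kappa hj sj subr0.
- case=> lam0 mu0.
  have nc j : j \in J -> ~ mu_is_c b lam mu q j.
    by move=> _ []; rewrite lam0 mul0r mulr0.
  have r0 : r = 0.
    by apply/eqP; rewrite -sqrf_eq0 r_sq lam0 mul0r.
  rewrite pairE // Lmod_plane -[_ :: _]/(map (module_of xi zeta b lam mu d) [:: @Plane k 0%N 0%R 0%R] ++ _).
  have -> : (2 * l + 1 = 2 + (size [:: @Plane k 0%N 0%R 0%R]
      + size (flatten [seq pair j | j <- J])))%N.
    by rewrite pair_size sizeJ; case: (l) l_gt0 => // n _; rewrite /=; ring.
  apply: six => //.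
  + exact: pair_uniq.
  + by move=> i; rewrite inE => /eqP ->; exists 0, 0; rewrite expr0n lam0 mul0r.
  + by move=> a c; rewrite r0 oppr0 => -[] -> [] ->; rewrite inE.
  + by move=> i /pairP[j [e [-> _]]]; exists j, e.
  + by move=> i /pairP[j [e [-> jJ]]]; apply: okS => //; exact: nc.
  + by move=> j e M v jJ gen; exists e; split=> //; rewrite mem_pair // memJ.
Qed.
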